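(* Let $d\geq 2$ and let $F$ be a compact convex set in $\mathbb{R}^{d-1}$ with ${\sf Vol}_{d-1}(F)=1$. Let $P=F\times[0,1]$ (the unit prism) and let $M$ be any unit mountain with floor $F$, i.e. $M={\sf CH}((F\times\{0\})\cup\{z\})$ for some $z\in\mathbb{R}^d$ with last coordinate $z_d=d$ (so ${\sf Vol}_d(M)=1$). Then for every $K\in{\sf SubPrism}(F)$, \[Q_M(2)\leq Q_K(2)\leq Q_P(2).\] Moreover $Q_M(2)=1-\frac{2}{d+1}$ and $Q_P(2)=1-\frac1d$ (in particular these values do not depend on $F$, nor on the choice of the unit mountain).
   Context: A compact convex set $K\subset\mathbb{R}^d$ has floor $F$ if $K$ is contained in the half-space $\{x_d\geq 0\}$ and $K\cap(\mathbb{R}^{d-1}\times\{0\})=F\times\{0\}$. ${\sf SubPrism}(F)$ denotes the set of compact convex sets $K$ with floor $F$, with ${\sf Vol}_d(K)=1$, and such that $K\subset F\times[0,H]$ for some $H\geq 0$. For such $K$ and $n\geq1$, $Q_K(n)$ denotes the probability that $n$ independent uniform random points $U_1,\dots,U_n$ in $K$ all lie on the boundary of the convex hull ${\sf CH}(\{U_1,\dots,U_n\}\cup (F\times\{0\}))$ (i.e. they are in convex position together with the floor). *)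

(* Defs.v *)
From HB Require Import structures.
From mathcomp Require Import all_boot all_order all_algebra.
From mathcomp Require Import all_classical all_reals all_analysis.
From mathcomp Require Import measurable_realfun.

Set Implicit Arguments.
Unset Strict Implicit.
Unset Printing Implicit Defensive.

Import Order.TTheory GRing.Theory Num.Theory.
Import numFieldNormedType.Exports.

Local Open Scope classical_set_scope.
Local Open Scope ring_scope.

(* The sigma-algebra on 'rV[R]_n is generated by the coordinates, as the
   library does for tuples; it contains the open sets (open_measurable_rV),
   hence is the Borel one. *)
Section measurable_rV.
Context {R : realType} {n : nat}.

Let coord (i : 'I_n) (v : 'rV[R]_n) : measurableTypeR R := v ord0 i.

Let rV_set0 : g_sigma_preimage coord set0.
Proof. exact: sigma_algebra0. Qed.

Let rV_setC A : g_sigma_preimage coord A -> g_sigma_preimage coord (~` A).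
Proof. exact: sigma_algebraC. Qed.

Let rV_bigcup (F : (set 'rV[R]_n)^nat) :
  (forall i, g_sigma_preimage coord (F i)) ->
  g_sigma_preimage coord (\bigcup_i F i).
Proof. exact: sigma_algebra_bigcup. Qed.

HB.instance Definition _ := @isMeasurable.Build default_measure_display
  'rV[R]_n (g_sigma_preimage coord) rV_set0 rV_setC rV_bigcup.

Lemma measurable_coord_rV (i : 'I_n) :
  measurable_fun [set: 'rV[R]_n] (fun v : 'rV[R]_n => v ord0 i : measurableTypeR R).
Proof.
move=> _ Y mY; rewrite setTI; apply: sub_sigma_algebra => /=.
rewrite -bigcup_seq/=; exists i => /=; first by rewrite mem_index_enum.
by exists Y => //; rewrite setTI.
Qed.

Lemma measurable_fun_rVP d (T : measurableType d) (f : T -> 'rV[R]_n) :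
  measurable_fun [set: T] f <->
  forall i, measurable_fun [set: T] (fun t => f t ord0 i : measurableTypeR R).
Proof.
split=> [mf i|mf].
  exact: (measurableT_comp (measurable_coord_rV i) mf).
move=> _ A mA; rewrite setTI.
suff: g_sigma_preimage coord `<=` [set B | measurable (f @^-1` B)] by apply.
apply: smallest_sub.
  split => /=.
  - by rewrite preimage_set0.
  - by move=> B mB; rewrite setTD preimage_setC; exact: measurableC.
  - by move=> F mF; rewrite preimage_bigcup; exact: bigcup_measurable.
rewrite -bigcup_seq => B [i _ [C mC <-]] /=.
by rewrite setTI; have := mf i measurableT C mC; rewrite setTI.
Qed.

Lemma open_measurable_rV (U : set 'rV[R]_n) : open U -> measurable U.
Proof.
move=> oU.
pose B (p : 'rV[rat]_n * nat) : set 'rV[R]_n :=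
  [set v | forall i, `|v ord0 i - ratr (p.1 ord0 i)| < p.2.+1%:R^-1].
have mB p : measurable (B p).
  have -> : B p = \bigcap_(i in [set: 'I_n])
      [set v : 'rV[R]_n | `|v ord0 i - ratr (p.1 ord0 i)| < p.2.+1%:R^-1].
    by apply/seteqP; split => v; [move=> Bv i _; exact: Bv|move=> Bv i; exact: (Bv i)].
  apply: fin_bigcap_measurable => // i _.
  have := measurable_coord_rV i => /(_ measurableT
    [set x | `|x - ratr (p.1 ord0 i)| < p.2.+1%:R^-1]).
  rewrite setTI; apply.
  rewrite (_ : [set _ | _] = ball (ratr (p.1 ord0 i) : R) p.2.+1%:R^-1).
    by apply: open_measurable; apply: ball_open; rewrite invr_gt0 ltr0n.
  by apply/seteqP; split => x /=; rewrite /ball /= distrC.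
have -> : U = \bigcup_(p in [set p | B p `<=` U]) B p.
  apply/seteqP; split => [v Uv|v [p /= BU]]; last exact: BU.
  have [/= e e0 eU] : exists2 e : R, 0 < e & ball v e `<=` U.
    by apply/nbhs_ballP; exact: open_nbhs_nbhs.
  have [k ke] : exists k : nat, k.+1%:R^-1 < e / 2.
    have e20 : 0 < e / 2 by rewrite divr_gt0.
    exists (Num.truncn (e / 2)^-1).
    rewrite invf_plt ?posrE//.
    exact: truncnS_gt.
  have [q qv] : exists q : 'rV[rat]_n,
      forall i, `|v ord0 i - ratr (q ord0 i)| < k.+1%:R^-1.
    have /choice[f fP] : forall i, exists q : rat,
        `|v ord0 i - ratr q| < k.+1%:R^-1.
      move=> i; have := @rat_in_itvoo R (v ord0 i - k.+1%:R^-1) (v ord0 i).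
      rewrite ltrBlDr ltrDl invr_gt0 ltr0n => /(_ isT)[q].
      rewrite in_itv/= => /andP[q1 q2]; exists q.
      by rewrite gtr0_norm ?subr_gt0// ltrBlDr addrC -ltrBlDr.
    by exists (\row_i f i) => i; rewrite mxE.
  exists (q, k) => //= w Bw; apply: eU.
  split=> // i j; rewrite ord1 /ball/=.
  rewrite (le_lt_trans (ler_distD (ratr (q ord0 j)) _ _))//.
  rewrite [ltRHS]splitr ltrD// (lt_trans _ ke)//.
  by rewrite distrC.
rewrite bigcup_mkcond; apply: countable_bigcupT_measurable => // p.
by case: ifPn => // _; exact: measurable0.
Qed.

End measurable_rV.

Section lebesgue_rV.
Context {R : realType}.

Definition rV_rcons n (p : 'rV[R]_n * measurableTypeR R) : 'rV[R]_n.+1 :=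
  \row_i oapp (p.1 ord0) p.2 (unlift ord_max i).

Definition rV_unrcons n (v : 'rV[R]_n.+1) : 'rV[R]_n * measurableTypeR R :=
  (col' ord_max v, v ord0 ord_max).

Lemma rV_rconsK n : cancel (@rV_rcons n) (@rV_unrcons n).
Proof.
move=> [v t]; rewrite /rV_unrcons /rV_rcons mxE unlift_none/=; congr (_, _).
by apply/rowP => i; rewrite !mxE liftK.
Qed.

Lemma rV_unrconsK n : cancel (@rV_unrcons n) (@rV_rcons n).
Proof.
by move=> v; apply/rowP => i; rewrite !mxE; case: unliftP => [j ->|->] //=;
  rewrite mxE.
Qed.

Lemma measurable_rV_rcons n : measurable_fun setT (@rV_rcons n).
Proof.
apply/measurable_fun_rVP => i.
rewrite [X in measurable_fun _ X](_ : _ =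
    fun p : 'rV[R]_n * measurableTypeR R =>
      oapp (p.1 ord0) p.2 (unlift ord_max i)); last first.
  by apply/funext => p; rewrite mxE.
case: (unlift ord_max i) => [j|] /=; last exact: measurable_snd.
exact: (measurableT_comp (measurable_coord_rV j) measurable_fst).
Qed.

Lemma measurable_rV_unrcons n : measurable_fun setT (@rV_unrcons n).
Proof.
apply/measurable_fun_pairP; split.
  apply/measurable_fun_rVP => i.
  rewrite [X in measurable_fun _ X](_ : _ =
    fun v : 'rV[R]_n.+1 => v ord0 (lift ord_max i)); last first.
    by apply/funext => v; rewrite /= mxE.
  exact: measurable_coord_rV.
exact: measurable_coord_rV.
Qed.

(* Lebesgue measure on R^n as the iterated product measure *)
Fixpoint lebesgue_rV n : set 'rV[R]_n -> \bar R :=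
  match n with
  | 0 => \d_(0 : 'rV[R]_0)
  | n'.+1 => pushforward (lebesgue_rV (n := n') \x lebesgue_measure)%E
                         (@rV_rcons n')
  end.

Section lebesgue_rV_step.
Variables (n : nat) (m : {sigma_finite_measure set 'rV[R]_n -> \bar R}).

Let step := pushforward (m \x lebesgue_measure)%E (@rV_rcons n).

Let step0 : step set0 = 0%E.
Proof. by rewrite /step /pushforward preimage_set0 measure0. Qed.

Let step_ge0 A : (0 <= step A)%E.
Proof. by rewrite /step /pushforward measure_ge0. Qed.

Let step_sigma_additive : semi_sigma_additive step.
Proof.
by apply: measure_semi_sigma_additive; exact: measurable_rV_rcons.
Qed.

#[local] HB.instance Definition _ := isMeasure.Build _ _ _ step
  step0 step_ge0 step_sigma_additive.

Let step_sigma_finite : sigma_finite setT step.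
Proof.
have /sigma_finiteP[F [TF ndF Foo]] := sigma_finiteT m.
have /sigma_finiteP[G [TG ndG Goo]] :=
  sigma_finiteT (@lebesgue_measure R : {sigma_finite_measure set _ -> \bar R}).
(* the library's sigma-finite instance for \x is shadowed by the one for
   probabilities, hence the direct proof *)
have FG : \bigcup_i (F i `*` G i) = setT.
  apply/seteqP; split => // -[x y] _.
  have [i _ Fx] : (\bigcup_i F i) x by rewrite -TF.
  have [j _ Gy] : (\bigcup_j G j) y by rewrite -TG.
  exists (maxn i j) => //; split => /=.
    by move: x Fx; exact/subsetPset/ndF/leq_maxl.
  by move: y Gy; exact/subsetPset/ndG/leq_maxr.
exists (fun i => @rV_unrcons n @^-1` (F i `*` G i)).
  by rewrite -preimage_bigcup FG preimage_setT.
move=> i; have [mF Fi] := Foo i; have [mG Gi] := Goo i.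
have mFG : measurable (F i `*` G i) by exact: measurableX.
split.
  by rewrite -[X in measurable X]setTI; exact: measurable_rV_unrcons.
rewrite /step /pushforward -comp_preimage (_ : _ \o _ = id); last first.
  by apply/funext => x /=; rewrite rV_rconsK.
by rewrite preimage_id product_measure1E// lte_mul_pinfty// ge0_fin_numE.
Qed.

#[local] HB.instance Definition _ := Measure_isSigmaFinite.Build _ _ _ step
  step_sigma_finite.

Lemma lebesgue_rV_step :
  exists m' : {sigma_finite_measure set 'rV[R]_n.+1 -> \bar R},
    step = m' :> (set _ -> _).
Proof. by exists step. Qed.

End lebesgue_rV_step.

Let lebesgue_rV_sigma_finite_measure n :
  exists m : {sigma_finite_measure set 'rV[R]_n -> \bar R},
    @lebesgue_rV n = m :> (set _ -> _).
Proof.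
elim: n => [|n [m mE]] /=; first by exists \d_(0 : 'rV[R]_0).
by rewrite mE; exact: lebesgue_rV_step.
Qed.

Section instances.
Variable n : nat.

Let lebesgue0 : @lebesgue_rV n set0 = 0%E.
Proof.
by have [m ->] := lebesgue_rV_sigma_finite_measure n; exact: measure0.
Qed.

Let lebesgue_ge0 A : (0 <= @lebesgue_rV n A)%E.
Proof.
by have [m ->] := lebesgue_rV_sigma_finite_measure n; exact: measure_ge0.
Qed.

Let lebesgue_sigma_additive : semi_sigma_additive (@lebesgue_rV n).
Proof.
have [m ->] := lebesgue_rV_sigma_finite_measure n.
exact: measure_semi_sigma_additive.
Qed.

HB.instance Definition _ := isMeasure.Build _ _ _ (@lebesgue_rV n)
  lebesgue0 lebesgue_ge0 lebesgue_sigma_additive.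

Let lebesgue_sigma_finite : sigma_finite setT (@lebesgue_rV n).
Proof.
by have [m ->] := lebesgue_rV_sigma_finite_measure n; exact: sigma_finiteT.
Qed.

HB.instance Definition _ := Measure_isSigmaFinite.Build _ _ _ (@lebesgue_rV n)
  lebesgue_sigma_finite.

End instances.

End lebesgue_rV.

Arguments lebesgue_rV {R n} A%_classical_set_scope.

Lemma compact_measurable_rV (R : realType) n (K : set 'rV[R]_n) :
  compact K -> measurable K.
Proof.
move=> cK.
have hrV : hausdorff_space 'rV[R]_n.
  move=> x y clxy; apply/rowP => i.
  apply: (@Rhausdorff R) => A B nA nB.
  have [z [Az Bz]] := clxy _ _ (@coord_continuous R 1 n ord0 i x _ nA)
    (@coord_continuous R 1 n ord0 i y _ nB).
  by exists (z ord0 i).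
rewrite -(setCK K); apply: measurableC; apply: open_measurable_rV.
by apply: closed_openC => x; exact: compact_closed.
Qed.

Section uniform_law.
Context {R : realType} {n : nat}.
Local Open Scope ereal_scope.

Definition uniform_law (K : set 'rV[R]_n) (A : set 'rV[R]_n) : \bar R :=
  lebesgue_rV (A `&` K) / lebesgue_rV K.

Lemma uniform_law_probability (K : set 'rV[R]_n) : measurable K ->
  0 < lebesgue_rV K -> lebesgue_rV K < +oo ->
  exists P : probability 'rV[R]_n R, uniform_law K = P :> (set _ -> _).
Proof.
move=> mK K0 Koo.
exists (mnormalize (mrestr lebesgue_rV mK) (\d_(0%R : 'rV[R]_n))).
have Kfin : lebesgue_rV K \is a fin_num by rewrite ge0_fin_numE// ltW.
apply/funext => A; rewrite /= /mnormalize /= /mrestr.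
rewrite [_ `&` K in X in if X then _ else _]setTI gt_eqF//= lt_eqF//=.
rewrite /uniform_law setTI; congr (_ * _).
by rewrite -{1}(fineK Kfin) inver fine_eq0// gt_eqF.
Qed.

End uniform_law.

Section iid.
Context d (T : measurableType d) (R : realType).

(* The law of n independent points of law P *)
Fixpoint iid (P : set T -> \bar R) n : set (n.-tuple T) -> \bar R :=
  match n with
  | 0 => \d_([tuple] : 0.-tuple T)
  | n'.+1 => pushforward (P \x iid P (n := n'))%E
                         (fun p : T * n'.-tuple T => [tuple of p.1 :: p.2])
  end.

Lemma iid_probability (P : probability T R) n :
  exists Q : probability (n.-tuple T) R, iid P (n := n) = Q :> (set _ -> _).
Proof.
elim: n => [|n [Q QE]] /=; first by exists \d_([tuple] : 0.-tuple T).
pose f (p : T * n.-tuple T) : n.+1.-tuple T := [tuple of p.1 :: p.2].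
have mf : measurable_fun setT f by exact: measurable_cons.
pose X := HB.pack_for {mfun (T * n.-tuple T)%type >-> n.+1.-tuple T} f
  (@isMeasurableFun.Build _ _ _ _ f mf).
by rewrite QE; exists (distribution (P \x Q)%E X).
Qed.

End iid.

Section floor.
Context {R : realType} {n : nat}.
Implicit Types (F : set 'rV[R]_n) (K : set 'rV[R]_n.+1).

Definition conv_hull m (A : set 'rV[R]_m) : set 'rV[R]_m :=
  smallest (@convex_set R 'rV[R]_m) A.

Definition boundary m (A : set 'rV[R]_m) : set 'rV[R]_m := closure A `\` A°.

(* F x I, the points of R^(n+1) with first n coordinates in F and last
   coordinate in I *)
Definition cylinder F (I : set R) : set 'rV[R]_n.+1 :=
  [set x | F (col' ord_max x) /\ I (x ord0 ord_max)].

Definition has_floor F K :=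
  K `<=` [set x | 0 <= x ord0 ord_max] /\
  K `&` cylinder setT [set 0] = cylinder F [set 0].

Definition SubPrism F K : Prop :=
  [/\ compact K, convex_set K, has_floor F K, lebesgue_rV K = 1%E &
     exists2 H : R, 0 <= H & K `<=` cylinder F `[0, H]].

Definition mountain F (z : 'rV[R]_n.+1) : set 'rV[R]_n.+1 :=
  conv_hull (cylinder F [set 0] `|` [set z]).

Definition convex_position_with_floor F m : set (m.-tuple 'rV[R]_n.+1) :=
  [set u | forall i, boundary (conv_hull ([set` u] `|` cylinder F [set 0]))
                              (tnth u i)].

(* The probability that m independent uniform points of K are in convex
   position together with the floor F *)
Definition Q F K m : \bar R :=
  iid (uniform_law K) (convex_position_with_floor F (m := m)).

End floor.

(* Main.v *)
Require Import Defs.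
From mathcomp Require Import all_boot all_order all_algebra.
From mathcomp Require Import all_classical all_reals all_analysis.
From mathcomp Require Import measurable_realfun lra.

(** Two points u, v fail to be in convex position with the floor exactly when one
    of them, say v, is interior to the cone over the floor with apex u: a point
    interior to the hull of a convex set and of itself already lies in that set.
    This open cone has volume h(u)/d, where h is the height, and for u in K it
    lies in K, so Q_K(2) = 1 - (2/d) * \int_K h, and only the first moment of
    t |-> |K_t|, the volumes of the horizontal slices, matters. All the profiles
    compared have integral 1, hence if two of them cross once, the one that lies
    above first has the smaller moment. The prism profile crosses that of K at
    t = 1, since |K_t| <= |F| = 1. The mountain profile (1 - t/d)^(d-1) crosses
    it at most once by the Brunn-Minkowski inequality, applied to the floor and
    a slice. *)

Set Implicit Arguments.
Unset Strict Implicit.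
Unset Printing Implicit Defensive.

Import Order.TTheory GRing.Theory Num.Theory.
Import numFieldNormedType.Exports.

Local Open Scope classical_set_scope.
Local Open Scope ring_scope.

(** * Lebesgue measure of slices and dilations *)

Section lebesgue_line.
Context {R : realType}.
Local Open Scope ereal_scope.
Local Notation mu := (@lebesgue_measure R).

(** The interior of the cone over F is an explicit set over the interior F°, given by a ratio of
    heights and a projection; this makes the set of bad pairs measurable, as Fubini requires.
    Passing to F° costs nothing, because a convex set of volume 1 has an interior of volume 1. The
    factor 2 appears because either point may be the interior one, and not both: the interior point
    is the one nearer to the floor. The mountain profile crosses only once because its (d-1)-th root
    1 - t/d is affine and starts, like that of K, at 1. Brunn-Minkowski puts the root of |K_t| above
    its chord from 0 to t1, so if K is above the mountain at t1, it is above at all lower heights.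
    The Brunn-Minkowski inequality is stated for a set C containing all sums, since the sumset of
    two measurable sets may fail to be measurable, and with bounds a^n <= |A| in place of n-th roots
    of volumes. *)

Lemma measurable_affine (k v : R) :
  measurable_fun [set: R] (fun x : R => (k * x + v)%R : measurableTypeR R).
Proof.
apply: (@measurable_funD _ _ _ _ (fun x => k * x)%R (cst v)) => //.
exact: (@measurable_funM _ _ _ _ (cst k) id).
Qed.

(** Scaled by k, the pushforward has the values of Lebesgue measure on the intervals ]a, b], and
    these determine the measure. *)
Lemma lebesgue_measure_affine (k v : R) (A : set R) : (0 < k)%R -> measurable A ->
  k%:E * mu ((fun x => k * x + v)%R @^-1` A) = mu A.
Proof.
move=> k0 mA.
have k0' : (0 <= k)%R by exact: ltW.
have mf := measurable_affine k v.
pose m' : {measure set measurableTypeR R -> \bar R} :=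
  pushforward mu (fun x : R => (k * x + v)%R : measurableTypeR R).
transitivity (mscale (NngNum k0') (m' mf) A) => //.
apply/esym/lebesgue_measure_unique => // _ [[a b] _ <-].
change (mu (`]a, b]%classic)%R =
  k%:E * mu ((fun x : R => (k * x + v)%R) @^-1` (`]a, b]%classic)%R)).
have -> : (fun x : R => (k * x + v)%R) @^-1` (`]a, b]%classic)%R =
    (`](a - v) / k, (b - v) / k]%classic)%R.
  apply/seteqP; split => x /=; rewrite !in_itv/= ltr_pdivrMr// ler_pdivlMr//;
  by rewrite ltrBlDr lerBrDr mulrC.
rewrite !lebesgue_measure_itv/= !lte_fin ltr_pM2r ?invr_gt0// ltrD2r.
case: ifPn => _; last by rewrite mule0.
rewrite -!EFinD -EFinM; congr EFin; rewrite -mulrBl mulrC divfK ?gt_eqF//; lra.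
Qed.

Lemma lebesgue_measure_sumset (A B C : set R) :
  measurable A -> measurable B -> measurable C ->
  A !=set0 -> B !=set0 ->
  has_ubound A -> has_lbound B ->
  (forall x y, A x -> B y -> C (x + y)%R) ->
  mu A + mu B <= mu C.
Proof.
(* With x in A close to sup A and y in B close to inf B, the set C contains
   A + y and x + B, which overlap at most in an interval of length e. *)
move=> mA mB mC A0 B0 Aub Blb ABC.
pose a := sup A; pose b := inf B.
apply/lee_addgt0Pr => e e0.
have e20 : (0 < e / 2)%R by rewrite divr_gt0.
have [x Ax xa] := sup_adherent e20 (conj A0 Aub).
have [y By yb] := inf_adherent e20 (conj B0 Blb).
pose Ay := (fun t => (1 * t + (- y))%R) @^-1` A.
pose Bx := (fun t => (1 * t + (- x))%R) @^-1` B.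
have mAy : measurable Ay by rewrite -[Ay]setTI; exact: measurable_affine.
have mBx : measurable Bx by rewrite -[Bx]setTI; exact: measurable_affine.
have <- : mu Ay = mu A by rewrite -(@lebesgue_measure_affine 1 (- y)%R A)// mul1e.
have <- : mu Bx = mu B by rewrite -(@lebesgue_measure_affine 1 (- x)%R B)// mul1e.
pose I := (`[a + b - e / 2, a + b + e / 2]%classic)%R.
have mI : mu I = e%:E.
  rewrite /I lebesgue_measure_itv/= lte_fin ltrD2l gtrN//.
  by rewrite -EFinD; congr EFin; lra.
have AB_I : Ay `&` Bx `<=` I.
  move=> t [/= At Bt]; rewrite /I/= in_itv/=.
  have := sup_ubound Aub At; have := inf_lbound Blb Bt.
  rewrite -/a -/b in xa yb *; move=> h1 h2; apply/andP; split; lra.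
have -> : mu Ay = mu (Ay `\` Bx) + mu (Ay `&` Bx) by exact: measureDI.
rewrite -addeA (addeC (mu (Ay `&` Bx))) addeA.
apply: leeD; last first.
  rewrite -mI; apply: le_measure => //; rewrite inE; first exact: measurableI.
  exact: measurable_itv.
rewrite -measureU//=; last 2 first.
- exact: measurableD.
- by rewrite setDE -setIA [~` _ `&` _]setIC setICr setI0.
rewrite le_measure ?inE//.
  by apply: measurableU => //; exact: measurableD.
move=> t [[/= At _]|/= Bt].
  by have := ABC _ _ At By; rewrite mul1r subrK.
by have := ABC _ _ Ax Bt; rewrite mul1r addrC subrK.
Qed.

End lebesgue_line.

Section lebesgue_space.
Context {R : realType}.
Local Open Scope ereal_scope.
Local Notation mu := (@lebesgue_measure R).

Lemma ge0_integral_affine (k v : R) (g : R -> \bar R) : (0 < k)%R ->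
  measurable_fun setT g -> (forall x, 0 <= g x) ->
  k%:E * (\int[mu]_x g (k * x + v)%R) = \int[mu]_x g x.
Proof.
move=> k0 mg g0; have k0' : (0 <= k)%R by exact: ltW.
have mf := measurable_affine k v.
pose m' : {measure set measurableTypeR R -> \bar R} :=
  pushforward mu (fun x : R => (k * x + v)%R : measurableTypeR R).
have -> : \int[mu]_x g (k * x + v)%R = \int[m' mf]_x g x.
  exact/esym/(@ge0_integral_pushforward _ _ (measurableTypeR R)
    (measurableTypeR R) R _ mf mu setT g measurableT mg (fun y _ => g0 y)).
rewrite -(@ge0_integral_mscale _ _ _ (m' mf) _ _ (NngNum k0'))//.
apply: eq_measure_integral => A mA _.
exact: lebesgue_measure_affine.
Qed.

Definition slice n (S : set 'rV[R]_n.+1) (t : R) : set 'rV[R]_n :=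
  [set x | S (rV_rcons (x, t))].

Lemma ysection_slice n (S : set 'rV[R]_n.+1) (t : R) :
  ysection (@rV_rcons R n @^-1` S) t = slice S t.
Proof. by apply/seteqP; split => x /=; rewrite /ysection/= inE. Qed.

Lemma measurable_preimage_rcons n (S : set 'rV[R]_n.+1) :
  measurable S -> measurable (@rV_rcons R n @^-1` S).
Proof. by move=> mS; rewrite -[X in measurable X]setTI; exact: measurable_rV_rcons. Qed.

Lemma measurable_slice n (S : set 'rV[R]_n.+1) (t : R) :
  measurable S -> measurable (slice S t).
Proof.
move=> mS; rewrite -ysection_slice; apply: measurable_ysection.
exact: measurable_preimage_rcons.
Qed.

Lemma measurable_lebesgue_slice n (S : set 'rV[R]_n.+1) :
  measurable S -> measurable_fun setT (fun t => lebesgue_rV (slice S t)).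
Proof.
move=> mS; have -> : (fun t => lebesgue_rV (slice S t)) =
    lebesgue_rV \o ysection (@rV_rcons R n @^-1` S).
  by apply/funext => t /=; rewrite ysection_slice.
exact: (measurable_fun_ysection lebesgue_rV (measurable_preimage_rcons mS)).
Qed.

Lemma ge0_integral_rV n (f : 'rV[R]_n.+1 -> \bar R) :
  measurable_fun setT f -> (forall x, 0 <= f x) ->
  \int[lebesgue_rV]_x f x =
  \int[mu]_t \int[lebesgue_rV]_x f (rV_rcons (x, t)).
Proof.
move=> mf f0; transitivity (\int[lebesgue_rV \x mu]_z f (@rV_rcons R n z)).
  exact: (ge0_integral_pushforward (@measurable_rV_rcons R n)
    (lebesgue_rV \x mu) measurableT mf (fun y _ => f0 y)).
rewrite fubini_tonelli2//.
exact: (measurableT_comp mf (@measurable_rV_rcons R n)).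
Qed.

Lemma lebesgue_rV_slice n (S : set 'rV[R]_n.+1) : measurable S ->
  lebesgue_rV S = \int[mu]_t lebesgue_rV (slice S t).
Proof.
move=> mS; rewrite -[S in LHS]setIT -integral_indic// ge0_integral_rV//.
  apply: eq_integral => t _; rewrite -[slice _ _]setIT -integral_indic//.
  exact: measurable_slice.
exact/measurable_EFinP/measurable_indic.
Qed.

Lemma measurable_affine_rV n (k : R) (v : 'rV[R]_n) :
  measurable_fun setT (fun x : 'rV[R]_n => k *: x + v)%R.
Proof.
apply/measurable_fun_rVP => i.
rewrite (_ : (fun t => _) = (fun t : 'rV[R]_n => k * t ord0 i + v ord0 i)%R).
  exact: (measurableT_comp (measurable_affine _ _) (measurable_coord_rV i)).
by apply/funext => t; rewrite !mxE.
Qed.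

Lemma rV_rcons_affine n k (v : 'rV[R]_n.+1) (x : 'rV[R]_n) (t : R) :
  (k *: rV_rcons (x, t) + v =
  rV_rcons (k *: x + col' ord_max v, k * t + v ord0 ord_max))%R.
Proof.
by apply/rowP => i; rewrite !mxE; case: unliftP => [j ->|->] /=; rewrite ?mxE.
Qed.

(** A slice of the preimage is the preimage of a slice under a map of the same kind, so one factor k
    comes from the line of heights and the others from induction. *)
Lemma lebesgue_rV_affine n (k : R) (v : 'rV[R]_n) (A : set 'rV[R]_n) :
  (0 < k)%R -> measurable A ->
  (k ^+ n)%:E * lebesgue_rV ((fun x => k *: x + v)%R @^-1` A) = lebesgue_rV A.
Proof.
move=> k0; elim: n v A => [|n IH] v A mA.
  rewrite expr0 mul1e; congr lebesgue_rV; apply/seteqP.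
  by split => x /=; rewrite (thinmx0 (_ + _)%R) (thinmx0 x).
have mB : measurable ((fun x => k *: x + v)%R @^-1` A).
  by rewrite -[X in measurable X]setTI; exact: measurable_affine_rV.
have sliceE t : slice ((fun x => k *: x + v)%R @^-1` A) t =
    (fun x => k *: x + col' ord_max v)%R @^-1` slice A (k * t + v ord0 ord_max).
  by apply/seteqP; split => x /=; rewrite /slice/= rV_rcons_affine.
rewrite [RHS]lebesgue_rV_slice// lebesgue_rV_slice//.
rewrite -(@ge0_integral_affine k (v ord0 ord_max)
  (fun s => lebesgue_rV (slice A s)))//; last first.
  exact: measurable_lebesgue_slice.
rewrite exprS EFinM -muleA; congr (_ * _).
rewrite -ge0_integralZl//; last 2 first.
- exact: measurable_lebesgue_slice.
- by rewrite lee_fin exprn_ge0// ltW.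
apply: eq_integral => t _; rewrite sliceE IH//; exact: measurable_slice.
Qed.

Lemma lebesgue_rV1_nonempty n (A : set 'rV[R]_n) : lebesgue_rV A = 1 -> A !=set0.
Proof.
move=> A1; apply/set0P/negP => /eqP A_eq0; move: A1.
by rewrite A_eq0 measure0 => /esym/eqP; rewrite onee_eq0.
Qed.

Lemma measurable_dilate n (k : R) (w : 'rV[R]_n) (A : set 'rV[R]_n) :
  measurable A -> measurable [set x | A (k *: (x - w))%R].
Proof.
move=> mA; rewrite (_ : [set x | _] = (fun x => k *: x + - (k *: w))%R @^-1` A).
  by rewrite -[X in measurable X]setTI; exact: measurable_affine_rV.
by apply/seteqP; split => x /=; rewrite scalerBr.
Qed.

Lemma lebesgue_rV_dilate n (k : R) (w : 'rV[R]_n) (A : set 'rV[R]_n) :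
  (0 < k)%R -> measurable A ->
  lebesgue_rV [set x | A (k^-1 *: (x - w))%R] = (k ^+ n)%:E * lebesgue_rV A.
Proof.
move=> k0 mA; have ki0 : (0 < k^-1)%R by rewrite invr_gt0.
rewrite -(lebesgue_rV_affine (- (k^-1 *: w))%R ki0 mA) muleA -EFinM -exprMn.
rewrite divff ?gt_eqF// expr1n mul1e; congr lebesgue_rV.
by apply/seteqP; split => x /=; rewrite scalerBr.
Qed.

End lebesgue_space.

(** * The Brunn-Minkowski inequality *)

Section layer_cake.
Context {R : realType}.
Local Notation mu := (@lebesgue_measure R).

(* Only levels s < 1 are kept: the layer cake formula is applied to functions
   with supremum 1, and below the supremum no superlevel set is empty. *)
Definition superlevel (f : R -> R) (s : R) : set R :=
  [set t | 0 < s < 1 /\ s <= f t].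

Let hypograph (f : R -> R) : set (R * R) := [set z | superlevel f z.2 z.1].

Let measurable_hypograph (f : R -> R) : measurable_fun setT f ->
  measurable (hypograph f : set (measurableTypeR R * measurableTypeR R)).
Proof.
move=> mf; have ms := @measurable_snd _ _ (measurableTypeR R) (measurableTypeR R).
have -> : hypograph f = (snd @^-1` (`]0, 1[%classic : set R)) `&`
    [set z | z.2 <= f z.1].
  by apply/seteqP; split => z /=; rewrite /hypograph/= /superlevel/= in_itv/=.
apply: measurableI.
  rewrite -[X in measurable X]setTI.
  exact: (ms measurableT _ (measurable_itv `]0, 1[)).
have mfst : measurable_fun setT (fun z : measurableTypeR R * measurableTypeR R => f z.1).
  exact: (measurableT_comp mf measurable_fst).
have := measurable_fun_ler ms mfst measurableT (Y := [set true]) I.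
rewrite setTI; congr measurable.
Qed.

Lemma measurable_superlevel (f : R -> R) (s : R) : measurable_fun setT f ->
  measurable (superlevel f s).
Proof.
move=> mf; have := measurable_ysection s (measurable_hypograph mf).
by congr measurable; apply/seteqP; split => t /=; rewrite /ysection/= inE.
Qed.

Lemma measurable_fun_superlevel (f : R -> R) : measurable_fun setT f ->
  measurable_fun setT (fun s => mu (superlevel f s)).
Proof.
move=> mf; have -> : (fun s => mu (superlevel f s)) =
    mu \o ysection (hypograph f).
  apply/funext => s /=; congr (mu _).
  by apply/seteqP; split => t /=; rewrite /ysection/= inE.
exact: (measurable_fun_ysection mu (measurable_hypograph mf)).
Qed.

(** Both sides are the area of the hypograph cut off at level 1, computed through its sections in
    either direction. *)
Lemma layer_cake (f : R -> R) : measurable_fun setT f -> (forall t, 0 <= f t) ->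
  (\int[mu]_t (Num.min (f t) 1)%:E = \int[mu]_s mu (superlevel f s))%E.
Proof.
move=> mf f0; have mH := measurable_hypograph mf.
transitivity ((mu \x mu)%E (hypograph f)).
  apply: eq_integral => t _ /=.
  have -> : xsection (hypograph f) t =
      [set s | 0 < s < 1 /\ s <= f t].
    by apply/seteqP; split => s /=; rewrite /xsection/= inE.
  have [f1|f1] := ltP (f t) 1.
    transitivity (mu (`]0, (f t)]%classic : set R)).
      by rewrite lebesgue_measure_itv/= lte_fin; case: ltP => h;
        [rewrite oppr0 addr0|congr EFin; apply/eqP; rewrite eq_le f0 h].
    congr (mu _); apply/seteqP; split => s /=; rewrite in_itv/=.
      by move=> /andP[-> h]; rewrite (le_lt_trans h).
    by move=> [/andP[-> _] ->].
  transitivity (mu (`]0, 1[%classic : set R)).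
    by rewrite lebesgue_measure_itv/= lte_fin ltr01 oppr0 addr0.
  congr (mu _); apply/seteqP; split => s /=; rewrite in_itv/=.
    by move=> /andP[s0 s1]; rewrite s0 s1 (le_trans (ltW s1)).
  by case.
rewrite (product_measure_unique (m' := (mu \x^ mu)%E))//; last first.
  by move=> *; exact: product_measure2E.
apply: eq_integral => s _ /=; congr (mu _).
by apply/seteqP; split => t /=; rewrite /ysection/= inE.
Qed.

End layer_cake.

(** Jensen's inequality for the power k + 1 with unnormalized weights p and q. The inductive step is
    Chebyshev's: u - w and u^(k+1) - w^(k+1) have the same sign. *)
Lemma power_mean_le (R : realFieldType) (p q u w : R) (k : nat) :
  0 <= p -> 0 <= q -> 0 <= u -> 0 <= w ->
  (p * u + q * w) ^+ k.+1 <= (p + q) ^+ k * (p * u ^+ k.+1 + q * w ^+ k.+1).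
Proof.
move=> p0 q0 u0 w0; elim: k => [|k IH]; first by rewrite expr0 mul1r !expr1.
rewrite exprS (le_trans (ler_wpM2l _ IH)) ?addr_ge0 ?mulr_ge0//.
rewrite mulrCA [leRHS](_ : _ = (p + q) ^+ k *
    ((p + q) * (p * u ^+ k.+2 + q * w ^+ k.+2))); last by rewrite exprSr mulrA.
apply: ler_wpM2l; first by rewrite exprn_ge0// addr_ge0.
set x := u ^+ k.+1; set y := w ^+ k.+1.
rewrite (exprS u) (exprS w) -/x -/y.
have : 0 <= p * q * ((u - w) * (x - y)).
  apply: mulr_ge0; first exact: mulr_ge0.
  have [uw|wu] := leP u w.
    by rewrite mulr_le0// subr_le0// lerXn2r ?nnegrE.
  by rewrite mulr_ge0// subr_ge0 ?lerXn2r ?nnegrE// ltW.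
lra.
Qed.

Lemma mulr_divX (R : realFieldType) (n : nat) (r c : R) : 0 < r ->
  r * (c / r) ^+ n.+1 = (r ^+ n)^-1 * c ^+ n.+1.
Proof.
move=> r0; rewrite expr_div_n (exprSr r) mulrC.
rewrite invrM ?unitfE ?expf_neq0 ?gt_eqF// (mulrC r^-1) mulrA divfK ?gt_eqF//.
by rewrite mulrC.
Qed.

Lemma exists_root (R : realType) (n : nat) (x : R) : 0 < x ->
  exists2 r : R, 0 < r & r ^+ n.+1 = x.
Proof.
move=> x0; exists (x `^ n.+1%:R^-1); first exact: powR_gt0.
by rewrite -powR_mulrn ?powR_ge0// -powRrM mulVf ?pnatr_eq0// powRr1// ltW.
Qed.

Section brunn_minkowski.
Context {R : realType}.
Local Notation mu := (@lebesgue_measure R).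

(** A bound on the coordinates is inherited by slices with the same N. It makes their volumes finite
    and the set of heights with a nonempty slice bounded. *)
Definition sup_bounded n (N : R) (A : set 'rV[R]_n) :=
  forall x, A x -> forall i, `|x ord0 i| <= N.

Lemma sup_bounded_slice n N (A : set 'rV[R]_n.+1) t :
  sup_bounded N A -> sup_bounded N (slice A t).
Proof.
move=> AN x Ax i; have := AN _ Ax (lift ord_max i).
by rewrite mxE liftK.
Qed.

Lemma sup_bounded_slice0 n N (A : set 'rV[R]_n.+1) t x :
  sup_bounded N A -> slice A t x -> `|t| <= N.
Proof. by move=> AN Ax; have := AN _ Ax ord_max; rewrite mxE unlift_none. Qed.

Lemma lebesgue_rV_bounded n N (A : set 'rV[R]_n) :
  0 <= N -> measurable A -> sup_bounded N A ->
  (lebesgue_rV A <= ((N + N) ^+ n)%:E)%E.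
Proof.
move=> N0; elim: n A => [|n IH] A mA AN.
  rewrite expr0 /= diracE lee_fin.
  by case: (_ \in _).
rewrite lebesgue_rV_slice//.
apply: (@le_trans _ _ (\int[mu]_(t in (`[- N, N]%classic)%R) ((N + N) ^+ n)%:E)%E).
  rewrite [leRHS]integral_mkcond; apply: ge0_le_integral => //.
  - exact: measurable_lebesgue_slice.
  - apply/(measurable_restrictT _ _).1; first exact: measurable_itv.
    exact: measurable_cst.
  - move=> t _; rewrite /patch; case: ifPn => [_|].
      apply: IH; [exact: measurable_slice|exact: sup_bounded_slice].
    rewrite notin_setE/= in_itv/= => tN.
    suff -> : slice A t = set0 by rewrite measure0.
    apply/seteqP; split => x //= Ax; apply: tN.
    by rewrite -ler_norml (sup_bounded_slice0 AN Ax).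
have mN : measurable (`[- N, N]%classic : set R) by exact: measurable_itv.
rewrite integral_cst//= lebesgue_measure_itv/= lte_fin.
case: ifPn => _; last by rewrite mule0 lee_fin exprn_ge0// addr_ge0.
by rewrite opprK -EFinD -EFinM exprSr.
Qed.

Let normalized_slice n (A : set 'rV[R]_n.+1) (k : R) (t : R) : R :=
  fine (lebesgue_rV (slice A t)) / k.

Let bm_sup n (N : R) (A : set 'rV[R]_n.+1) : 0 <= N -> measurable A ->
  sup_bounded N A -> (0 < lebesgue_rV A)%E ->
  exists2 k : R, 0 < k & ereal_sup (range (fun t => lebesgue_rV (slice A t))) = k%:E.
Proof.
move=> N0 mA AN A0.
set s := ereal_sup _.
have s_ub t : (lebesgue_rV (slice A t) <= s)%E by apply: ereal_sup_ubound; exists t.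
have sN : (s <= ((N + N) ^+ n)%:E)%E.
  apply: ge_ereal_sup => _ [t _ <-]; apply: lebesgue_rV_bounded => //.
    exact: measurable_slice.
  exact: sup_bounded_slice.
have s0 : (0 < s)%E.
  rewrite ltNge; apply/negP => s0; move: A0; rewrite ltNge => /negP; apply.
  rewrite lebesgue_rV_slice// integral0_eq// => t _.
  by apply/eqP; rewrite eq_le measure_ge0 (le_trans (s_ub t) s0).
case: s s_ub sN s0 => [k| |] // _ _ k0.
by exists k => //; rewrite -lte_fin.
Qed.

Let measurable_normalized_slice n (A : set 'rV[R]_n.+1) (k : R) :
  measurable A -> measurable_fun setT (normalized_slice A k).
Proof.
move=> mA; apply: measurable_funM; last exact: measurable_cst.
exact: (measurableT_comp (fine_measurable measurableT)
  (measurable_lebesgue_slice mA)).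
Qed.

Let normalized_slice_ge0 n (A : set 'rV[R]_n.+1) (k : R) t : 0 < k ->
  0 <= normalized_slice A k t.
Proof. by move=> k0; rewrite divr_ge0 ?fine_ge0 ?measure_ge0// ltW. Qed.

(** Meant for C, where k need not bound the slice volumes: truncation at 1 may lose mass, which
    leaves an inequality in the useful direction. *)
Let le_integral_superlevel n N (A : set 'rV[R]_n.+1) (k : R) :
  0 <= N -> measurable A -> sup_bounded N A -> 0 < k ->
  (\int[mu]_s mu (superlevel (normalized_slice A k) s) <=
   k^-1%:E * lebesgue_rV A)%E.
Proof.
move=> N0 mA AN k0; have mS := measurable_normalized_slice k mA.
rewrite -layer_cake//; last by move=> t; exact: normalized_slice_ge0.
rewrite lebesgue_rV_slice// -ge0_integralZl//=; last 2 first.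
- exact: measurable_lebesgue_slice.
- by rewrite lee_fin invr_ge0 ltW.
apply: ge0_le_integral => //=.
- by move=> t _; rewrite lee_fin le_min normalized_slice_ge0//=.
- have mm := measurable_minr mS (measurable_cst (1 : R)).
  exact: (measurableT_comp (@EFin_measurable R setT) mm).
- by apply: measurable_funeM; exact: measurable_lebesgue_slice.
move=> t _; rewrite (@le_trans _ _ (normalized_slice A k t)%:E)//.
  by rewrite lee_fin ge_min lexx.
rewrite /normalized_slice mulrC EFinM fineK// ge0_fin_numE ?measure_ge0//.
rewrite (le_lt_trans (lebesgue_rV_bounded N0 _ (sup_bounded_slice AN)))//.
  exact: measurable_slice.
exact: ltry.
Qed.

(** Meant for A and B, where k is the supremum of the slice volumes, so that truncation at 1 changes
    nothing. *)
Let ge_integral_superlevel n N (A : set 'rV[R]_n.+1) (k : R) :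
  0 <= N -> measurable A -> sup_bounded N A -> 0 < k ->
  (forall t, lebesgue_rV (slice A t) <= k%:E)%E ->
  (k^-1%:E * lebesgue_rV A <=
   \int[mu]_s mu (superlevel (normalized_slice A k) s))%E.
Proof.
move=> N0 mA AN k0 Ak; have mS := measurable_normalized_slice k mA.
rewrite -layer_cake//; last by move=> t; exact: normalized_slice_ge0.
rewrite lebesgue_rV_slice// -ge0_integralZl//=; last 2 first.
- exact: measurable_lebesgue_slice.
- by rewrite lee_fin invr_ge0 ltW.
rewrite le_eqVlt; apply/orP; left; apply/eqP/eq_integral => t _.
have fA : lebesgue_rV (slice A t) \is a fin_num.
  by rewrite ge0_fin_numE ?measure_ge0// (le_lt_trans (Ak t))// ltry.
rewrite min_l; last first.
  rewrite /normalized_slice ler_pdivrMr// mul1r -lee_fin fineK//.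
by rewrite /normalized_slice mulrC EFinM fineK.
Qed.

Let lebesgue_rV0 (D : set 'rV[R]_0) : (0 < lebesgue_rV D)%E -> lebesgue_rV D = 1%E.
Proof. by rewrite /= diracE; case: (_ \in _) => //; rewrite ltxx. Qed.

(** For n = 0 the slices have volume 0 or 1 and one of them has volume 1, so the supremum is 1 = p
    ^+ 0; otherwise p is a root. *)
Let sup_root n (N : R) (A : set 'rV[R]_n.+1) : 0 <= N -> measurable A ->
  sup_bounded N A -> (0 < lebesgue_rV A)%E ->
  exists2 p : R, 0 < p &
    ereal_sup (range (fun t => lebesgue_rV (slice A t))) = (p ^+ n)%:E.
Proof.
move=> N0 mA AN A0; have [k k0 kE] := bm_sup N0 mA AN A0.
case: n A mA AN A0 kE => [|n] A mA AN A0 kE; last first.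
  by have [p p0 pk] := exists_root n k0; exists p => //; rewrite pk.
exists 1 => //; rewrite expr0.
have [_ [t _ <-]] := ereal_sup_gt (x := 0%E)
  (S := range (fun t => lebesgue_rV (slice A t))) ltac:(by rewrite kE lte_fin).
move=> At0; apply/eqP; rewrite eq_le; apply/andP; split.
  apply: ge_ereal_sup => _ [u _ <-].
  by rewrite /= diracE lee_fin; case: (_ \in _).
by apply: ereal_sup_ubound; exists t => //; exact: lebesgue_rV0.
Qed.

(** For n > 0, r is the n-th root of s. In dimension 0 there is none, since r ^+ 0 = 1 > s, but
    there a positive volume is already 1; hence the inequality [s <= r ^+ n]. *)
Let level_root n (s : R) : 0 < s < 1 -> exists r : R, [/\ 0 < r, s <= r ^+ n &
  forall (p : R) (D : set 'rV[R]_n), 0 < p ->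
    ((s * p ^+ n)%:E <= lebesgue_rV D -> ((r * p) ^+ n)%:E <= lebesgue_rV D)%E].
Proof.
move=> /andP[s0 s1]; case: n => [|n].
  exists 1; split => //; first by rewrite expr0 ltW.
  move=> p D p0; rewrite !expr0 mulr1 => sD.
  by rewrite lebesgue_rV0// (lt_le_trans _ sD).
have [r r0 rs] := exists_root n s0; exists r; split => //; first by rewrite rs.
by move=> p D p0; rewrite exprMn rs.
Qed.

(* Induction on n. The slice volumes of A and B are divided by their suprema
   p ^+ n and q ^+ n; below level s < 1 the induction hypothesis makes the sum of
   the superlevel sets of A and B part of the superlevel set of C, and the
   one-dimensional inequality is integrated over s. *)
Lemma brunn_minkowski n (N : R) (A B C : set 'rV[R]_n) (a b : R) : 0 <= N ->
  measurable A -> measurable B -> measurable C ->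
  sup_bounded N A -> sup_bounded N B -> sup_bounded N C ->
  (forall x y, A x -> B y -> C (x + y)) ->
  0 < a -> 0 < b ->
  ((a ^+ n)%:E <= lebesgue_rV A)%E -> ((b ^+ n)%:E <= lebesgue_rV B)%E ->
  (((a + b) ^+ n)%:E <= lebesgue_rV C)%E.
Proof.
move=> N0.
elim: n A B C a b => [|n IH] A B C a b mA mB mC AN BN CN ABC a0 b0 aA bB.
  move: aA bB; rewrite !expr0 /= !diracE !lee_fin.
  have [A0|] := boolP (0 \in A); last by rewrite ler10.
  have [B0|] := boolP (0 \in B); last by rewrite ler10.
  rewrite !inE in A0 B0; suff -> : 0 \in C by [].
  by rewrite inE -[0]addr0; exact: ABC.
have A0 : (0 < lebesgue_rV A)%E by rewrite (lt_le_trans _ aA)// lte_fin exprn_gt0.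
have B0 : (0 < lebesgue_rV B)%E by rewrite (lt_le_trans _ bB)// lte_fin exprn_gt0.
have [p p0 pE] := sup_root N0 mA AN A0.
have [q q0 qE] := sup_root N0 mB BN B0.
have pq0 : 0 < p + q by exact: addr_gt0.
have fin_slice (D : set 'rV[R]_n.+1) t : measurable D -> sup_bounded N D ->
    lebesgue_rV (slice D t) \is a fin_num.
  move=> mD DN; rewrite ge0_fin_numE ?measure_ge0//.
  rewrite (le_lt_trans (lebesgue_rV_bounded N0 _ (sup_bounded_slice DN)))//.
    exact: measurable_slice.
  exact: ltry.
have levelP (D : set 'rV[R]_n.+1) k s t : measurable D -> sup_bounded N D ->
    0 < k -> superlevel (normalized_slice D k) s t <->
    0 < s < 1 /\ ((s * k)%:E <= lebesgue_rV (slice D t))%E.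
  move=> mD DN k0; rewrite /superlevel/= /normalized_slice ler_pdivlMr//.
  by rewrite -lee_fin fineK ?fin_slice.
have bnd (D : set 'rV[R]_n.+1) k s t : measurable D -> sup_bounded N D ->
    0 < k -> superlevel (normalized_slice D k) s t -> `|t| <= N.
  move=> mD DN k0 /(levelP _ _ _ _ mD DN k0)[] /andP[s0 _] sD.
  have [[x Dx]|D0] := pselect (exists x, slice D t x).
    exact: sup_bounded_slice0 DN Dx.
  move: sD; suff -> : slice D t = set0.
    by rewrite measure0 lee_fin leNgt mulr_gt0.
  by apply/seteqP; split => x // Dx; apply: D0; exists x.
have nonempty (D : set 'rV[R]_n.+1) r s : measurable D -> sup_bounded N D ->
    0 < r -> ereal_sup (range (fun t => lebesgue_rV (slice D t))) = (r ^+ n)%:E ->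
    0 < s < 1 -> superlevel (normalized_slice D (r ^+ n)) s !=set0.
  move=> mD DN r0 rE /andP[s0 s1].
  have [_ [t _ <-] tD] := ereal_sup_gt (x := (s * r ^+ n)%:E)
    (S := range (fun t => lebesgue_rV (slice D t)))
    ltac:(by rewrite rE lte_fin gtr_pMl// exprn_gt0).
  exists t; apply/levelP => //; first exact: exprn_gt0.
  by rewrite s0 s1 ltW.
have main : ((p ^+ n)^-1%:E * lebesgue_rV A + (q ^+ n)^-1%:E * lebesgue_rV B <=
    ((p + q) ^+ n)^-1%:E * lebesgue_rV C)%E.
  apply: (@le_trans _ _ (\int[mu]_s (mu (superlevel (normalized_slice A (p ^+ n)) s) +
      mu (superlevel (normalized_slice B (q ^+ n)) s)))%E).
    rewrite ge0_integralD//; last 2 first.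
    - exact: (measurable_fun_superlevel (measurable_normalized_slice _ _)).
    - exact: (measurable_fun_superlevel (measurable_normalized_slice _ _)).
    apply: leeD; apply: (ge_integral_superlevel N0) => //; rewrite ?exprn_gt0//.
      by move=> t; rewrite -pE; apply: ereal_sup_ubound; exists t.
    by move=> t; rewrite -qE; apply: ereal_sup_ubound; exists t.
  apply: (le_trans _ (le_integral_superlevel N0 mC CN _)); last exact: exprn_gt0.
  apply: ge0_le_integral => //.
  - by move=> s _; rewrite adde_ge0.
  - by apply: emeasurable_funD;
      exact: (measurable_fun_superlevel (measurable_normalized_slice _ _)).
  - exact: (measurable_fun_superlevel (measurable_normalized_slice _ _)).
  move=> s _.
  have [s01|s01] := boolP (0 < s < 1); last first.
    have e f : superlevel f s = set0.
      by apply/seteqP; split => t // [+ _]; rewrite (negbTE s01).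
    by rewrite !e measure0 adde0.
  have mS (D : set 'rV[R]_n.+1) k : measurable D ->
      measurable (superlevel (normalized_slice D k) s).
    by move=> mD; exact: (measurable_superlevel _ (measurable_normalized_slice _ _)).
  apply: lebesgue_measure_sumset; [exact: mS|exact: mS|exact: mS|
    exact: nonempty|exact: nonempty| | |].
  - exists N => t /(bnd _ _ _ _ mA AN (exprn_gt0 n p0)).
    by rewrite ler_norml => /andP[].
  - exists (- N) => t /(bnd _ _ _ _ mB BN (exprn_gt0 n q0)).
    by rewrite ler_norml => /andP[].
  move=> t t' /(levelP _ _ _ _ mA AN (exprn_gt0 n p0))[_ At].
  move=> /(levelP _ _ _ _ mB BN (exprn_gt0 n q0))[_ Bt].
  apply/(levelP _ _ _ _ mC CN (exprn_gt0 n pq0)); split => //.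
  (* The level s is common to A and B, so the induction hypothesis is applied to the radii r * p and
     r * q, whose sum is r * (p + q). *)
  have [r [r0 sr rP]] := level_root n s01.
  rewrite (@le_trans _ _ ((r * p + r * q) ^+ n)%:E)//.
    by rewrite lee_fin -mulrDr exprMn ler_wpM2r// exprn_ge0// ltW.
  apply: (IH (slice A t) (slice B t')); rewrite ?mulr_gt0//;
    do ?[exact: measurable_slice|exact: sup_bounded_slice]; do ?exact: rP.
  move=> x y Ax By; have := ABC _ _ Ax By.
  congr C; apply/rowP => i; rewrite !mxE.
  by case: unliftP => [j _|_] //=; rewrite mxE.
have finE (D : set 'rV[R]_n.+1) : measurable D -> sup_bounded N D ->
    lebesgue_rV D = (fine (lebesgue_rV D))%:E.
  move=> mD DN; rewrite fineK// ge0_fin_numE ?measure_ge0//.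
  by rewrite (le_lt_trans (lebesgue_rV_bounded N0 mD DN))// ltry.
move: main aA bB; rewrite (finE A)// (finE B)// (finE C)//.
rewrite -!EFinM -EFinD !lee_fin => main aA bB.
apply: (@le_trans _ _ ((p + q) ^+ n * (((p + q) ^+ n)^-1 * fine (lebesgue_rV C))));
  last by rewrite mulVKf// gt_eqF// exprn_gt0.
(* With u = a / p and w = b / q the left side is (a + b)^(n+1), and the terms on the right are
   a^(n+1) / p^n and b^(n+1) / q^n, as in [main]. *)
have := power_mean_le n (ltW p0) (ltW q0) (divr_ge0 (ltW a0) (ltW p0))
  (divr_ge0 (ltW b0) (ltW q0)).
rewrite (mulrC p (a / p)) (mulrC q (b / q)) !divfK ?gt_eqF// => /le_trans; apply.
rewrite ler_wpM2l ?exprn_ge0 ?(ltW pq0)// (le_trans _ main)//.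
by rewrite !mulr_divX//; apply: lerD; rewrite ler_wpM2l// invr_ge0 exprn_ge0// ltW.
Qed.

End brunn_minkowski.

(** * Slice profiles on the line *)

Section profiles.
Context {R : realType}.
Local Notation mu := (@lebesgue_measure R).

Lemma le_moment_of_crossing (f g : R -> R) (t0 : R) :
  measurable_fun setT f -> measurable_fun setT g ->
  (forall t, 0 <= f t) -> (forall t, 0 <= g t) ->
  (forall t, t < 0 -> f t = 0 /\ g t = 0) ->
  (\int[mu]_t (f t)%:E = 1)%E -> (\int[mu]_t (g t)%:E = 1)%E ->
  0 <= t0 ->
  (forall t, 0 <= t < t0 -> g t <= f t) -> (forall t, t0 < t -> f t <= g t) ->
  (\int[mu]_t (t * f t)%R%:E <= \int[mu]_t (t * g t)%R%:E)%E.
Proof.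
move=> mf mg f0 g0 neg0 If Ig t00 gf fg.
have pos (h : R -> R) : (forall t, 0 <= h t) -> (forall t, t < 0 -> h t = 0) ->
    forall t, 0 <= t * h t.
  move=> h0 hneg t; have [t_ge0|t_lt0] := leP 0 t; first exact: mulr_ge0.
  by rewrite hneg// mulr0.
have pf := pos f f0 (fun t t0 => (neg0 t t0).1).
have pg := pos g g0 (fun t t0 => (neg0 t t0).2).
have mid (h : R -> R) : measurable_fun setT h -> measurable_fun setT (fun t : R => t * h t).
  by move=> mh; exact: measurable_funM.
have mE (h : R -> R) : measurable_fun setT h -> measurable_fun setT (EFin \o h).
  by move=> mh; exact/measurable_EFinP.
have split (h k : R -> R) : measurable_fun setT h -> measurable_fun setT k ->
    (forall t, 0 <= t * h t) -> (forall t, 0 <= k t) ->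
    (\int[mu]_t (t * h t + t0 * k t)%R%:E =
     \int[mu]_t (t * h t)%R%:E + t0%:E * \int[mu]_t (k t)%:E)%E.
  move=> mh mk h0 k0; rewrite -ge0_integralZl//=.
  - rewrite -ge0_integralD//=.
    + by move=> t _; rewrite lee_fin.
    + exact: (mE _ (mid _ mh)).
    + by move=> t _; rewrite -EFinM lee_fin mulr_ge0.
    + by apply: measurable_funeM; exact: mE.
  - exact: mE.
  - by move=> t _; rewrite lee_fin.
(* (t - t0) (f t - g t) <= 0, rearranged so that only nonnegative functions are
   integrated *)
have : (\int[mu]_t (t * f t + t0 * g t)%R%:E <= \int[mu]_t (t * g t + t0 * f t)%R%:E)%E.
  apply: ge0_le_integral => //=.
  - by move=> t _; rewrite lee_fin addr_ge0// mulr_ge0.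
  - apply: (mE (fun t => t * f t + t0 * g t)).
    by apply: measurable_funD; [exact: mid|exact: measurable_funM].
  - apply: (mE (fun t => t * g t + t0 * f t)).
    by apply: measurable_funD; [exact: mid|exact: measurable_funM].
  - move=> t _; rewrite lee_fin.
    suff : (t - t0) * (f t - g t) <= 0 by lra.
    have [t_lt0|t_ge0] := ltP t 0.
      by have [-> ->] := neg0 t t_lt0; rewrite subrr mulr0.
    have [tt0|tt0|->] := ltgtP t t0; last by rewrite subrr mul0r.
      apply: mulr_le0_ge0; first by rewrite subr_le0 ltW.
      by rewrite subr_ge0 gf// t_ge0.
    apply: mulr_ge0_le0; first by rewrite subr_ge0 ltW.
    by rewrite subr_le0 fg.
by rewrite !split// If Ig leeD2rE.
Qed.

(* Volume of the slice at height t of a cone of height h over a floor of volume 1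
   in dimension k; the values k = 0 and h = 1 give the unit prism. *)
Definition cone_profile (k : nat) (h : R) (t : R) : R :=
  if 0 <= t <= h then (1 - t / h) ^+ k else 0.

Lemma cone_profile_ge0 k h t : 0 < h -> 0 <= cone_profile k h t.
Proof.
move=> h0; rewrite /cone_profile; case: ifPn => // /andP[_ th].
by rewrite exprn_ge0// subr_ge0 ler_pdivrMr// mul1r.
Qed.

Let cone_profile_restrict k h :
  cone_profile k h = (fun t => (1 - t / h) ^+ k) \_ `[0, h].
Proof.
by apply/funext => t; rewrite patchE/= /cone_profile mem_setE in_itv/=.
Qed.

Lemma measurable_cone_profile k h : measurable_fun setT (cone_profile k h).
Proof.
rewrite cone_profile_restrict; apply/(measurable_restrictT _ _).1.
  exact: measurable_itv.
by apply: measurable_funX; apply: measurable_funB => //; exact: measurable_funM.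
Qed.

(** The substitution t = h x reduces it to the integral of (1 - x)^k over [0, 1]. *)
Lemma integral_cone_profile k h : 0 < h ->
  (\int[mu]_t (cone_profile k h t)%:E = (h / k.+1%:R)%R%:E)%E.
Proof.
move=> h0.
rewrite -(@ge0_integral_affine R h 0 (EFin \o cone_profile k h))//; first last.
- by move=> t; rewrite lee_fin cone_profile_ge0.
- by apply/measurable_EFinP; exact: measurable_cone_profile.
rewrite EFinM; congr (_ * _)%E.
rewrite -(Rintegral_onemXn k) /Rintegral fineK; last first.
  rewrite (_ : (fun x => _) = EFin \o @XMonemX R 0 k).
    apply: integrable_fin_num; first exact: measurable_itv.
    exact: integrable_XMonemX.
  by apply/funext => x; rewrite /= /XMonemX expr0 mul1r.
rewrite [RHS]integral_mkcond; apply: eq_integral => t _ /=.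
rewrite /cone_profile addr0 patchE/= mem_setE in_itv/=.
rewrite pmulr_rge0// ger_pMr//.
by case: ifPn => //; rewrite [h * t]mulrC mulfK// gt_eqF.
Qed.

(** From t (1 - t/h)^k = h (1 - t/h)^k - h (1 - t/h)^(k+1) the moment is h (h/(k+1) - h/(k+2)). The
    identity is integrated in its additive form, with nonnegative terms only. *)
Lemma moment_cone_profile k h : 0 < h ->
  (\int[mu]_t (t * cone_profile k h t)%R%:E = (h ^+ 2 / (k.+1%:R * k.+2%:R))%R%:E)%E.
Proof.
move=> h0.
have : (\int[mu]_t (t * cone_profile k h t)%R%:E +
    h%:E * \int[mu]_t (cone_profile k.+1 h t)%:E =
    h%:E * \int[mu]_t (cone_profile k h t)%:E)%E.
  have m0 j : measurable_fun setT (EFin \o cone_profile j h).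
    by apply/measurable_EFinP; exact: measurable_cone_profile.
  have scale j : (h%:E * \int[mu]_t (cone_profile j h t)%:E =
      \int[mu]_t (h%:E * (cone_profile j h t)%:E))%E.
    rewrite ge0_integralZl_EFin//; [by move=> t _; rewrite lee_fin cone_profile_ge0
      |exact: m0|exact: ltW].
  rewrite !scale.
  rewrite -ge0_integralD//=; last 4 first.
  - move=> t _; rewrite lee_fin; have [t_ge0|t_lt0] := leP 0 t.
      by rewrite mulr_ge0// cone_profile_ge0.
    by rewrite /cone_profile (leNgt 0 t) t_lt0 mulr0.
  - by apply/measurable_EFinP; apply: measurable_funM => //; exact: measurable_cone_profile.
  - by move=> t _; rewrite -EFinM lee_fin mulr_ge0// ?cone_profile_ge0// ltW.
  - by apply: measurable_funeM; exact: m0.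
  apply: eq_integral => t _; rewrite -!EFinM -EFinD; congr EFin.
  rewrite /cone_profile; case: ifPn => _; last by rewrite !mulr0 addr0.
  rewrite exprS mulrA -mulrDl; congr (_ * _).
  by rewrite mulrBr mulr1 mulrCA divff ?gt_eqF// mulr1 addrC subrK.
rewrite !integral_cone_profile// -!EFinM.
move=> /(congr1 (fun x => x - (h * (h / k.+2%:R))%R%:E)%E); rewrite addeK// -EFinB => ->.
congr EFin; rewrite -[in RHS](natr1 k.+1).
have k1 : (k.+1%:R : R) != 0 by rewrite pnatr_eq0.
have k2 : (k.+1%:R + 1 : R) != 0 by rewrite natr1 pnatr_eq0.
rewrite -(natr1 k.+1) -mulrBr expr2 -mulrA; congr (_ * _).
rewrite -mulrBr; congr (_ * _).
apply: (mulIf (mulf_neq0 k1 k2)); rewrite mulVf ?mulf_neq0// mulrBl mulKf//.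
by rewrite mulrCA mulVf// mulr1 addrAC subrr add0r.
Qed.

End profiles.

(** * Cones and interiors of convex sets *)

Section convexity.
Context {R : realType}.

Lemma convex_setP m (A : set 'rV[R]_m) :
  convex_set A <-> forall x y s, A x -> A y -> 0 <= s <= 1 ->
    A (s *: x + (1 - s) *: y).
Proof.
split=> [cA x y s Ax Ay /andP[s0 s1]|cA x y l].
  have := cA x y (Itv01 s0 s1); rewrite !inE; exact.
rewrite !inE => Ax Ay; apply: (cA x y l%:num) => //.
by rewrite ge0 le1.
Qed.

Lemma interiorP m (A : set 'rV[R]_m) x :
  A° x <-> exists2 r : R, 0 < r & ball x r `<=` A.
Proof.
rewrite /interior; split.
  by move=> /nbhs_ballP[r /= r0 rA]; exists r.
by move=> [r r0 rA]; apply/nbhs_ballP; exists r.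
Qed.

Lemma ball_rVP m (x y : 'rV[R]_m) (r : R) :
  ball x r y <-> 0 < r /\ forall i, `|x ord0 i - y ord0 i| < r.
Proof.
split=> [[r0 xy]|[r0 xy]]; split => // i; first exact: xy.
by move=> j; rewrite ord1; exact: xy.
Qed.

Lemma ball_rV_normP m (x y : 'rV[R]_m) (r : R) : ball x r y <-> `|x - y| < r.
Proof. by rewrite -ball_normE. Qed.

Lemma ball_rV_rconsP m (x y : 'rV[R]_m) (s t r : R) :
  ball (rV_rcons (x, s)) r (rV_rcons (y, t)) <-> ball x r y /\ `|s - t| < r.
Proof.
split=> [/ball_rVP[r0 h]|[/ball_rVP[r0 h] st]].
  split; last by have := h ord_max; rewrite !mxE unlift_none.
  by apply/ball_rVP; split => // i; have := h (lift ord_max i); rewrite !mxE liftK.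
apply/ball_rVP; split => // i; rewrite !mxE.
by case: unliftP => [j _|_] //=.
Qed.

Definition cone m (A : set 'rV[R]_m) (v : 'rV[R]_m) : set 'rV[R]_m :=
  [set x | exists a s, [/\ A a, 0 <= s <= 1 & x = s *: a + (1 - s) *: v]].

Lemma sub_cone m (A : set 'rV[R]_m) v : A `<=` cone A v.
Proof.
move=> a Aa; exists a, 1; split => //; first by rewrite ler01 lexx.
by rewrite scale1r subrr scale0r addr0.
Qed.

Lemma cone_apex m (A : set 'rV[R]_m) v : A !=set0 -> cone A v v.
Proof.
move=> [a Aa]; exists a, 0; split => //; first by rewrite lexx ler01.
by rewrite scale0r add0r subr0 scale1r.
Qed.

Lemma cone_sub m (A B : set 'rV[R]_m) v :
  convex_set B -> A `<=` B -> B v -> cone A v `<=` B.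
Proof.
by move=> /convex_setP cB AB Bv _ [a [s [Aa s01 ->]]]; apply: cB => //; exact: AB.
Qed.

(** A combination puts weights p and q on two points of A and the rest on v. The two points merge
    into one of weight p + q, unless p + q = 0 and only the apex is left. *)
Lemma convex_cone m (A : set 'rV[R]_m) v : convex_set A -> convex_set (cone A v).
Proof.
move=> /convex_setP cA; apply/convex_setP.
move=> _ _ r [a [s [Aa /andP[s0 s1] ->]]] [a' [s' [Aa' /andP[s0' s1'] ->]]].
move=> /andP[r0 r1].
pose p := r * s; pose q := (1 - r) * s'.
have p0 : 0 <= p by rewrite mulr_ge0.
have q0 : 0 <= q by rewrite mulr_ge0// subr_ge0.
have pq1 : p + q <= 1.
  have : p <= r by rewrite /p ler_piMr.
  have : q <= 1 - r by rewrite /q ler_piMr// subr_ge0.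
  lra.
have -> : r *: (s *: a + (1 - s) *: v) + (1 - r) *: (s' *: a' + (1 - s') *: v) =
    p *: a + q *: a' + (1 - (p + q)) *: v.
  by apply/rowP => i; rewrite !mxE /p /q; lra.
have [pq_eq0|pq_neq0] := eqVneq (p + q) 0.
  have p_eq0 : p = 0 by lra.
  have q_eq0 : q = 0 by lra.
  rewrite p_eq0 q_eq0 !scale0r add0r addr0 subr0 scale1r add0r.
  by apply: cone_apex; exists a.
have pq_gt0 : 0 < p + q by rewrite lt_neqAle eq_sym pq_neq0 addr_ge0.
exists (p / (p + q) *: a + (1 - p / (p + q)) *: a'), (p + q); split.
- apply: cA => //; rewrite divr_ge0 ?addr_ge0//= ler_pdivrMr// mul1r lerDl//.
- by rewrite addr_ge0.
- congr (_ + _); rewrite scalerDr !scalerA mulrBr mulr1 mulrCA divff// mulr1.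
  by rewrite addrAC subrr add0r.
Qed.

(* A point of the cone slightly beyond v, seen from a point a0 of A, shows that v
   lies on a segment with ends in A. *)
Lemma interior_cone m (A : set 'rV[R]_m) v : convex_set A -> A !=set0 ->
  (cone A v)° v -> A v.
Proof.
move=> /convex_setP cA [a0 Aa0] /interiorP[r r0 rA].
pose e := r / (1 + `|v - a0|).
have d0 : 0 < 1 + `|v - a0| by rewrite ltr_pwDl.
have e0 : 0 < e by rewrite divr_gt0.
have [a [s [Aa /andP[s0 s1] aE]]] : cone A v (v + e *: (v - a0)).
  apply/rA/ball_rV_normP; rewrite opprD addrA subrr add0r normrN normrZ gtr0_norm//.
  by rewrite /e mulrAC ltr_pdivrMr// ltr_pM2l// ltrDr.
clearbody e; have se0 : 0 < s + e by rewrite ltr_wpDl.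
have -> : v = s / (s + e) *: a + (1 - s / (s + e)) *: a0.
  have H : (s + e) *: v = s *: a + e *: a0.
    apply/rowP => i; have /rowP/(_ i) := aE; rewrite !mxE; lra.
  have -> : 1 - s / (s + e) = e / (s + e).
    by rewrite -[1](@divff _ (s + e)) ?gt_eqF// -mulrBl addrAC subrr add0r.
  rewrite ![_ / (s + e)]mulrC -!scalerA -scalerDr -H scalerA mulVf ?gt_eqF//.
  by rewrite scale1r.
apply: cA => //; rewrite divr_ge0 ?(ltW se0)//= ler_pdivrMr// mul1r lerDl.
exact: ltW.
Qed.

Lemma convex_shrink_interior m (A : set 'rV[R]_m) c k x : convex_set A ->
  A° c -> A x -> 0 <= k < 1 -> A° (k *: x + (1 - k) *: c).
Proof.
move=> /convex_setP cA /interiorP[r r0 rA] Ax /andP[k0 k1].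
have k1' : 0 < 1 - k by rewrite subr_gt0.
apply/interiorP; exists ((1 - k) * r); first exact: mulr_gt0.
move=> y /ball_rV_normP xy.
have -> : y = k *: x + (1 - k) *: ((1 - k)^-1 *: (y - k *: x)).
  by rewrite scalerA divff ?gt_eqF// scale1r addrC subrK.
apply: cA => //; last by rewrite k0 ltW.
apply/rA/ball_rV_normP.
rewrite -(ltr_pM2l k1') -[X in X * `|_|]gtr0_norm// -normrZ scalerBr scalerA.
rewrite divff ?gt_eqF// scale1r opprB.
move: xy; congr (`|_| < _).
by apply/rowP => i; rewrite !mxE; lra.
Qed.

End convexity.

(** * Volume and interior of convex sets *)

Section interior_measure.
Context {R : realType}.
Local Notation mu := (@lebesgue_measure R).

Lemma rV_rcons_comb n (x y : 'rV[R]_n) (a b s t : R) :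
  a *: rV_rcons (x, s) + b *: rV_rcons (y, t) =
  rV_rcons (a *: x + b *: y, a * s + b * t).
Proof.
by apply/rowP => i; rewrite !mxE; case: unliftP => [j _|_] /=; rewrite ?mxE.
Qed.

Lemma convex_slice n (A : set 'rV[R]_n.+1) t : convex_set A -> convex_set (slice A t).
Proof.
move=> /convex_setP cA; apply/convex_setP => x y s Ax Ay s01.
have := cA _ _ _ Ax Ay s01; rewrite rV_rcons_comb /slice/=.
by rewrite -mulrDl (addrC s) subrK mul1r.
Qed.

(** Slice volumes and profiles are compared away from one exceptional height, that of the floor or
    of the apex. *)
Lemma integral_eq_off_point (f g : R -> \bar R) (c : R) :
  measurable_fun setT f -> measurable_fun setT g ->
  (forall t, 0 <= f t)%E -> (forall t, 0 <= g t)%E ->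
  (forall t, t != c -> f t = g t) ->
  (\int[mu]_t f t = \int[mu]_t g t)%E.
Proof.
move=> mf mg f0 g0 fg.
have mc : measurable ([set c] : set (measurableTypeR R)) by exact: measurable_set1.
have c0 : mu [set c] = 0%E by exact: lebesgue_measure_set1.
rewrite (ge0_negligible_integral mc measurableT mf _ c0)//.
rewrite [RHS](ge0_negligible_integral mc measurableT mg _ c0)//.
by apply: eq_integral => t; rewrite inE => -[_ /= /eqP]; exact: fg.
Qed.

Lemma convex_interior_nonempty n (A : set 'rV[R]_n) : measurable A ->
  convex_set A -> (0 < lebesgue_rV A)%E -> A° !=set0.
Proof.
elim: n A => [|n IH] A mA cA A0.
  have [x Ax] : A !=set0.
    by apply/set0P/negP => /eqP A_eq0; move: A0; rewrite A_eq0 measure0 ltxx.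
  exists x; apply/interiorP; exists 1 => // y _.
  by rewrite (thinmx0 y) -(thinmx0 x).
(* The hull of interior points of two distinct slices contains a ball. *)
have [t [t' [tt' At At']]] : exists t t', [/\ t < t',
    (0 < lebesgue_rV (slice A t))%E & (0 < lebesgue_rV (slice A t'))%E].
  apply: contrapT => H; move: A0; apply/negP; rewrite -leNgt lebesgue_rV_slice//.
  have [[t0 At0]|noA] := pselect (exists t0, (0 < lebesgue_rV (slice A t0))%E).
    rewrite (@integral_eq_off_point _ (cst 0%E) t0)//.
    - by rewrite integral0.
    - exact: measurable_lebesgue_slice.
    - move=> t tt0; apply/eqP; rewrite eq_le measure_ge0 andbT leNgt.
      apply/negP => At; apply: H; move: tt0; rewrite neq_lt => /orP[tt0|tt0].
        by exists t, t0.
      by exists t0, t.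
  rewrite integral0_eq// => t _.
  apply/eqP; rewrite eq_le measure_ge0 andbT leNgt; apply/negP => At.
  by apply: noA; exists t.
have [c /interiorP[r r0 rA]] := IH _ (measurable_slice t mA) (convex_slice cA) At.
have [c' /interiorP[r' r0' rA']] := IH _ (measurable_slice t' mA) (convex_slice cA) At'.
pose rho := Num.min r r'.
have rho0 : 0 < rho by rewrite lt_min r0.
have ttd : 0 < t' - t by rewrite subr_gt0.
pose L := `|c' - c| / (t' - t).
have L0 : 0 <= L by rewrite divr_ge0// ltW.
(* A change of height by less than d moves the point of the segment from c to c' at that height by
   at most L * d, so the horizontal offset w of a point of the ball is less than d * (1 + L) <= rho,
   and c and c' can both be shifted by w. The second bound keeps the height between t and t'. *)
pose d := Num.min (rho / (1 + L)) ((t' - t) / 2).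
have d0 : 0 < d by rewrite lt_min !divr_gt0// ltr_wpDr.
exists (rV_rcons (2^-1 *: (c + c'), 2^-1 * (t + t'))).
apply/interiorP; exists d => // z.
rewrite -[z]rV_unrconsK /rV_unrcons.
move: (col' ord_max z) (z ord0 ord_max) => {z} y s /ball_rV_rconsP[/ball_rV_normP yd sd].
pose l := (s - t) / (t' - t).
have lE : l * (t' - t) = s - t by rewrite /l divfK// gt_eqF.
have [sd1 sd2] : (`|2^-1 * (t + t') - s| < (t' - t) / 2)%R /\ d * (1 + L) <= rho.
  split; first by rewrite (lt_le_trans sd)// ge_min lexx orbT.
  by rewrite -ler_pdivlMr ?ltr_wpDr// ge_min lexx.
have /andP[l0 l1] : 0 <= l <= 1.
  rewrite /l divr_ge0 ?(ltW ttd)//=; last by move: sd1; rewrite ltr_norml; lra.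
  by rewrite ler_pdivrMr// mul1r; move: sd1; rewrite ltr_norml; lra.
pose w := y - ((1 - l) *: c + l *: c').
have wrho : `|w| < rho.
  have wE : w = - (2^-1 *: (c + c') - y) + (2^-1 - l) *: (c' - c).
    by apply/rowP => i; rewrite !mxE; lra.
  rewrite wE (le_lt_trans (ler_normD _ _))// normrN normrZ.
  rewrite (lt_le_trans _ sd2)// mulrDr mulr1 ltr_leD//.
  have -> : `|2^-1 - l| = `|2^-1 * (t + t') - s| / (t' - t).
    rewrite -[X in _ / X]gtr0_norm// -normf_div; congr (`|_|).
    by apply: (mulIf (lt0r_neq0 ttd)); rewrite divfK ?gt_eqF// mulrBl lE; lra.
  rewrite mulrAC -mulrA ler_wpM2r//; last exact: ltW.
have Hc : A (rV_rcons (c + w, t)).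
  apply/rA/ball_rV_normP; rewrite opprD addrA subrr add0r normrN.
  by rewrite (lt_le_trans wrho)// ge_min lexx.
have Hc' : A (rV_rcons (c' + w, t')).
  apply/rA'/ball_rV_normP; rewrite opprD addrA subrr add0r normrN.
  by rewrite (lt_le_trans wrho)// ge_min lexx orbT.
have := (convex_setP _).1 cA _ _ (1 - l) Hc Hc'.
rewrite subKr rV_rcons_comb subr_ge0 l1 gerBl l0 => /(_ isT).
congr A; congr (rV_rcons (_, _)).
  by apply/rowP => i; rewrite !mxE; lra.
by lra.
Qed.

Lemma lebesgue_rV_interior n (A : set 'rV[R]_n) : measurable A -> convex_set A ->
  lebesgue_rV A = 1%E -> lebesgue_rV A° = 1%E.
Proof.
case: n A => [|n] A mA cA A1.
  rewrite -A1; congr lebesgue_rV; apply/seteqP; split; first exact: interior_subset.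
  move=> x Ax; apply/interiorP; exists 1 => // y _.
  by rewrite (thinmx0 y) -(thinmx0 x).
have mAi : measurable A° by apply: open_measurable_rV; exact: open_interior.
have [c cA'] : A° !=set0 by apply: convex_interior_nonempty => //; rewrite A1.
apply/eqP; rewrite eq_le; apply/andP; split.
  by rewrite -A1 le_measure ?inE//; exact: interior_subset.
rewrite leNgt; apply/negP => Ai_lt1.
have Ai_fin : lebesgue_rV A° \is a fin_num.
  by rewrite ge0_fin_numE ?measure_ge0// (lt_trans Ai_lt1)// ltry.
(* Halfway between the volume of A° and 1: a homothetic copy of A of volume q is too large to fit
   into A°. *)
pose q := (1 + fine (lebesgue_rV A°)) / 2.
have Ai0 : 0 <= fine (lebesgue_rV A°) by rewrite fine_ge0// measure_ge0.
have Ai1 : fine (lebesgue_rV A°) < 1 by rewrite -lte_fin fineK.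
have q0 : 0 < q by rewrite /q; lra.
have q1 : q < 1 by rewrite /q; lra.
have [k k0 kq] := exists_root n q0.
have k1 : k < 1.
  rewrite ltNge; apply/negP => k1; move: q1; rewrite -kq ltNge => /negP; apply.
  exact: exprn_ege1.
(* The homothetic copy of ratio k < 1 of A about c is contained in A°. *)
have : (q%:E <= lebesgue_rV A°)%E.
  rewrite -kq -(lebesgue_rV_affine ((1 - k) *: c) k0 mAi) -[leLHS]mule1 -A1.
  rewrite lee_wpmul2l ?lee_fin ?exprn_ge0 ?(ltW k0)// le_measure ?inE//.
    by rewrite -[X in measurable X]setTI; exact: measurable_affine_rV.
  by move=> x Ax; apply: convex_shrink_interior => //; rewrite (ltW k0).
by rewrite -(fineK Ai_fin) lee_fin leNgt /q => /negP; apply; lra.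
Qed.

End interior_measure.

(** * The open cone over the floor *)

Section dome.
Context {R : realType} {n : nat}.
Implicit Types (F G : set 'rV[R]_n) (u v x : 'rV[R]_n.+1).
Local Notation mu := (@lebesgue_measure R).
Local Notation height v := (v ord0 ord_max).
Local Notation base F := (cylinder F [set 0]).

(* The points strictly between the floor and the height of u whose projection to
   the floor from u lies in G. If u has height 0 then the quotient is 0 and the
   dome is empty; negative heights are allowed, which makes the set of pairs in
   convex position measurable without restriction to K. *)
Definition dome G u : set 'rV[R]_n.+1 :=
  [set v : 'rV[R]_n.+1 | 0 < height v / height u < 1 /\
    G ((1 - height v / height u)^-1 *:
        (col' ord_max v - (height v / height u) *: col' ord_max u))].

Lemma col'_rcons (y : 'rV[R]_n) (t : R) :
  col' ord_max (rV_rcons (y, t)) = y :> 'rV[R]_n.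
Proof. by have /(congr1 fst) := rV_rconsK (y, t). Qed.

Lemma base_rcons F y : F y -> base F (rV_rcons (y, 0)).
Proof.
move=> Fy; split; last by rewrite /= mxE unlift_none.
by rewrite col'_rcons.
Qed.

Lemma convex_base F : convex_set F -> convex_set (base F).
Proof.
move=> /convex_setP cF; apply/convex_setP => x y s [Fx /= x0] [Fy /= y0] s01; split.
  have := cF _ _ _ Fx Fy s01; congr F.
  by apply/rowP => i; rewrite !mxE.
by rewrite /= !mxE x0 y0 !mulr0 addr0.
Qed.

Lemma base_nonempty F : F !=set0 -> base F !=set0.
Proof. by move=> [y Fy]; exists (rV_rcons (y, 0)); exact: base_rcons. Qed.

(** The weight s now sits on the apex, so that it is the ratio of the heights of x and u. *)
Lemma cone_baseP F u x : cone (base F) u x <-> exists y s,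
  [/\ F y, 0 <= s <= 1, col' ord_max x = (1 - s) *: y + s *: col' ord_max u &
      height x = s * height u].
Proof.
split=> [[a [s [[Fa /= a0] s01 ->]]]|[y [s [Fy /andP[s0 s1] xy xh]]]].
  exists (col' ord_max a), (1 - s); split => //.
  - by rewrite subr_ge0 gerBl andbC.
  - by apply/rowP => i; rewrite !mxE subKr.
  - by rewrite !mxE a0 mulr0 add0r.
exists (rV_rcons (y, 0)), (1 - s); split.
- exact: base_rcons.
- by rewrite subr_ge0 gerBl s0 s1.
- rewrite subKr; apply/rowP => i; rewrite !mxE.
  case: unliftP => [j ->|->] /=; last by rewrite mulr0 add0r.
  by have /rowP/(_ j) := xy; rewrite !mxE.
Qed.

Lemma dome_sub_cone F u : dome F u `<=` cone (base F) u.
Proof.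
move=> v [/andP[s0 s1] Fv]; apply/cone_baseP.
have u0 : height u != 0.
  by apply/eqP => u0; move: s0; rewrite u0 invr0 mulr0 ltxx.
exists ((1 - height v / height u)^-1 *:
  (col' ord_max v - (height v / height u) *: col' ord_max u)),
  (height v / height u); split.
- exact: Fv.
- by rewrite (ltW s0) (ltW s1).
- by rewrite scalerA divff ?subr_eq0 1?eq_sym ?lt_eqF// scale1r subrK.
- by rewrite divfK.
Qed.

(** Moving v up and down puts its height strictly between 0 and that of u. Moving it horizontally by
    (1 - s) * (y - y0) moves its projection from y0 to y, so a ball about y0 lies in F. *)
Lemma interior_cone_base F u v : (cone (base F) u)° v -> dome F° u v.
Proof.
move=> /interiorP[r r0 rA].
have r20 : 0 < r / 2 by rewrite divr_gt0.
have nearv x : (forall i, `|x ord0 i| < r) -> cone (base F) u (v + x).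
  move=> xr; apply/rA/ball_rVP; split => // i.
  by rewrite mxE opprD addrA subrr add0r normrN.
have vert t : `|t| < r -> exists s, 0 <= s <= 1 /\ height v + t = s * height u.
  move=> tr; have : cone (base F) u (v + rV_rcons (0, t)).
    apply: nearv => i; rewrite mxE.
    by case: unliftP => [j _|_] //=; rewrite mxE normr0.
  move=> /cone_baseP[y [s [_ s01 _ hE]]]; exists s; split => //.
  by rewrite -hE !mxE unlift_none.
have [s [/andP[s0 s1]]] := vert 0 ltac:(by rewrite normr0).
rewrite addr0 => vs.
have [s' [/andP[s'0 s'1] vs']] := vert (r / 2) ltac:(by rewrite gtr0_norm//; lra).
have [s'' [/andP[s''0 s''1] vs'']] := vert (- (r / 2)) ltac:(by rewrite normrN gtr0_norm//; lra).
have u0 : height u != 0 by apply/eqP => u0; move: vs vs'; rewrite u0 !mulr0; lra.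
have sE : height v / height u = s by rewrite vs mulfK.
have /andP[s_gt0 s_lt1] : 0 < s < 1.
  have d1 : (s' - s) * height u = r / 2 by rewrite mulrBl -vs -vs'; lra.
  have d2 : (s - s'') * height u = r / 2 by rewrite mulrBl -vs -vs''; lra.
  have [u_gt0|u_lt0] : 0 < height u \/ height u < 0.
    by move: u0; rewrite neq_lt => /orP[]; [right|left].
  - have : 0 < s' - s by rewrite -(pmulr_lgt0 _ u_gt0) d1.
    have : 0 < s - s'' by rewrite -(pmulr_lgt0 _ u_gt0) d2.
    by move=> h1 h2; apply/andP; split; lra.
  - have : s' - s < 0 by rewrite -(nmulr_lgt0 _ u_lt0) d1.
    have : s - s'' < 0 by rewrite -(nmulr_lgt0 _ u_lt0) d2.
    by move=> h1 h2; apply/andP; split; lra.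
rewrite /dome/= sE; split; first by rewrite s_gt0.
have os0 : 0 < 1 - s by rewrite subr_gt0.
apply/interiorP; exists r => // y /ball_rVP[_ yr].
pose y0 := (1 - s)^-1 *: (col' ord_max v - s *: col' ord_max u).
have : cone (base F) u (v + rV_rcons ((1 - s) *: (y - y0), 0)).
  apply: nearv => i; rewrite mxE.
  case: unliftP => [j _|_] /=; last by rewrite normr0.
  rewrite 3!mxE normrM gtr0_norm// distrC.
  by apply: le_lt_trans (yr j); rewrite ler_piMl// gerBl.
move=> /cone_baseP[z [t [Fz t01 zE hE]]].
have ts : t = s.
  apply: (mulIf u0); rewrite -vs -hE !mxE unlift_none/=; lra.
suff -> : y = z by [].
apply/rowP => i; have /rowP/(_ i) := zE.
rewrite ts !mxE liftK/= !mxE => H.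
apply: (mulfI (lt0r_neq0 os0)).
have : (1 - s) * ((1 - s)^-1 * (v ord0 (lift ord_max i) - s * u ord0 (lift ord_max i))) =
   v ord0 (lift ord_max i) - s * u ord0 (lift ord_max i).
  by rewrite mulVKf// gt_eqF.
move: H; rewrite mulrBr; lra.
Qed.

Lemma continuous_col'_max : continuous (fun v : 'rV[R]_n.+1 => col' ord_max v).
Proof.
move=> v A /nbhs_ballP[e e0 eA]; apply/nbhs_ballP; exists e => // w.
move=> /ball_rVP[_ vw]; apply: eA; apply/ball_rVP; split => // i.
by rewrite !mxE.
Qed.

Lemma open_dome F u : open (dome F° u).
Proof.
rewrite openE => v [/andP[s0 s1] Fv]; rewrite /interior.
have s1' : 1 - height v / height u != 0 by rewrite subr_eq0 gt_eqF.
have cs : (fun x : 'rV[R]_n.+1 => height x / height u) @ v --> height v / height u.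
  have ch : (fun x : 'rV[R]_n.+1 => height x) @ v --> height v.
    exact: (@coord_continuous R 1 n.+1 ord0 ord_max v).
  exact: (cvgM ch (cvg_cst _)).
have c1s : (fun x : 'rV[R]_n.+1 => 1 - height x / height u) @ v -->
    1 - height v / height u.
  exact: (cvgB (cvg_cst _) cs).
have cphi : (fun x : 'rV[R]_n.+1 => (1 - height x / height u)^-1 *:
    (col' ord_max x - (height x / height u) *: col' ord_max u)) @ v -->
    (1 - height v / height u)^-1 *:
    (col' ord_max v - (height v / height u) *: col' ord_max u).
  exact: (cvgZ (cvgV s1' c1s)
    (cvgB (@continuous_col'_max v) (cvgZ cs (cvg_cst (col' ord_max u))))).
have nF := open_nbhs_nbhs (conj (@open_interior _ F) Fv).
near=> x; rewrite /dome/=; split.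
  apply/andP; split; near: x.
    exact: (cvgr_gt _ cs).
  exact: (cvgr_lt _ cs).
near: x; exact: (cphi _ nF).
Unshelve. all: by end_near. Qed.

Lemma convex_conv_hull m (A : set 'rV[R]_m) : convex_set (conv_hull A).
Proof.
apply/convex_setP => x y s Ax Ay s01 B cAB.
by apply: (convex_setP B).1 => //; [exact: cAB.1|exact: (Ax _ cAB)|exact: (Ay _ cAB)].
Qed.

Lemma interior_hullP F u v : convex_set F -> F !=set0 ->
  (conv_hull ([set u; v] `|` base F))° v <-> dome F° u v.
Proof.
move=> cF F0; set H := conv_hull _.
have cH : convex_set H by exact: convex_conv_hull.
have subH : [set u; v] `|` base F `<=` H by exact: sub_gen_smallest.
have cb := convex_base cF; have b0 := base_nonempty F0.
have cc := @convex_cone _ _ _ u cb.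
(* The hull is contained in the cone with apex v over the cone with apex u, so
   that v, being interior to it, already lies in the cone with apex u. *)
split=> [Hv|Dv].
- have HC : H `<=` cone (cone (base F) u) v.
    apply: smallest_sub; first exact: convex_cone.
    move=> x [[->|->]|bx].
    + by apply: sub_cone; exact: cone_apex.
    + by apply: cone_apex; exists u; exact: cone_apex.
    + by do 2 apply: sub_cone.
  have Cv : cone (base F) u v.
    apply: interior_cone => //; first by exists u; exact: cone_apex.
    exact: (interiorS HC Hv).
  apply: interior_cone_base; apply: interiorS Hv.
  by apply: subset_trans HC _; exact: cone_sub.
- have : (dome F° u)° v by have := @open_dome F u; rewrite openE; exact.
  apply: interiorS; move=> w Dw; have : cone (base F) u w.
    by apply: dome_sub_cone; case: Dw => ? ?; split => //; exact: interior_subset.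
  apply: cone_sub => //; last by apply: subH; left; left.
  by move=> x bx; apply: subH; right.
Qed.

End dome.

Section dome_measure.
Context {R : realType} {n : nat}.
Implicit Types (G : set 'rV[R]_n) (K : set 'rV[R]_n.+1) (u v : 'rV[R]_n.+1).
Local Notation mu := (@lebesgue_measure R).
Local Notation height v := (v ord0 ord_max).

Lemma measurable_invr : measurable_fun setT (fun x : R => x^-1).
Proof.
have -> : [set: R] = [set 0] `|` ~` [set 0] by rewrite setUv.
apply/measurable_funU; [exact: measurable_set1|
  by apply: measurableC; exact: measurable_set1|split].
  exact: measurable_fun_set1.
apply: open_continuous_measurable_fun.
  by apply: closed_openC; exact: closed_eq.
move=> x; rewrite inE/= => x0; apply: inv_continuous.
by apply/eqP.
Qed.

Lemma measurable_dome_graph G : measurable G ->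
  measurable [set p : 'rV[R]_n.+1 * 'rV[R]_n.+1 | dome G p.1 p.2].
Proof.
move=> mG.
pose ratio (p : 'rV[R]_n.+1 * 'rV[R]_n.+1) : R := height p.2 / height p.1.
pose phi (p : 'rV[R]_n.+1 * 'rV[R]_n.+1) : 'rV[R]_n :=
  (1 - ratio p)^-1 *: (col' ord_max p.2 - ratio p *: col' ord_max p.1).
have m1 (i : 'I_n.+1) : measurable_fun setT
    (fun p : 'rV[R]_n.+1 * 'rV[R]_n.+1 => p.1 ord0 i).
  exact: (measurableT_comp (measurable_coord_rV i) measurable_fst).
have m2 (i : 'I_n.+1) : measurable_fun setT
    (fun p : 'rV[R]_n.+1 * 'rV[R]_n.+1 => p.2 ord0 i).
  exact: (measurableT_comp (measurable_coord_rV i) measurable_snd).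
have mratio : measurable_fun setT ratio.
  apply: measurable_funM; first exact: m2.
  exact: (measurableT_comp measurable_invr (m1 ord_max)).
have m1r : measurable_fun setT (fun p => 1 - ratio p).
  exact: (measurable_funB (measurable_cst (1 : R)) mratio).
have mphi : measurable_fun setT phi.
  apply/measurable_fun_rVP => i.
  have -> : (fun t => phi t ord0 i) = fun p : 'rV[R]_n.+1 * 'rV[R]_n.+1 =>
      (1 - ratio p)^-1 * (p.2 ord0 (lift ord_max i) -
        ratio p * p.1 ord0 (lift ord_max i)).
    by apply/funext => p; rewrite /phi !mxE.
  apply: (@measurable_funM _ _ _ _ (fun p => (1 - ratio p)^-1)).
    exact: (measurableT_comp measurable_invr m1r).
  apply: measurable_funB; first exact: m2.
  exact: (measurable_funM mratio (m1 _)).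
have -> : [set p : 'rV[R]_n.+1 * 'rV[R]_n.+1 | dome G p.1 p.2] =
    (ratio @^-1` `]0, 1[) `&` (phi @^-1` G).
  by apply/seteqP; split => p; rewrite /dome/= in_itv.
apply: measurableI.
  by rewrite -[X in measurable X]setTI; apply: mratio => //; exact: measurable_itv.
rewrite -[X in measurable X]setTI; exact: mphi.
Qed.

Lemma measurable_dome G u : measurable G -> measurable (dome G u).
Proof.
move=> mG; have := measurable_xsection u (measurable_dome_graph mG).
by congr measurable; apply/seteqP; split => v /=; rewrite /xsection/= inE.
Qed.

Lemma slice_dome G u (t : R) x : slice (dome G u) t x <->
  0 < t / height u < 1 /\
  G ((1 - t / height u)^-1 *: (x - (t / height u) *: col' ord_max u)).
Proof. by rewrite /slice/dome/= mxE unlift_none col'_rcons. Qed.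

(** The slice is a homothetic copy of G of ratio 1 - t / h. At t = 0 the dome has no points while
    the profile is 1, and at t = h the profile is 0 ^+ n, which is 1 for n = 0. *)
Lemma lebesgue_slice_dome G u (t : R) : measurable G -> lebesgue_rV G = 1%E ->
  0 < height u -> t != 0 -> t != height u ->
  lebesgue_rV (slice (dome G u) t) = (cone_profile n (height u) t)%:E.
Proof.
move=> mG G1 u0 t0 tu.
have [s01|s01] := boolP (0 < t / height u < 1); last first.
  have -> : slice (dome G u) t = set0.
    by apply/seteqP; split => x // /slice_dome[+ _]; rewrite (negbTE s01).
  rewrite measure0 /cone_profile; case: ifPn => // /andP[t_ge0 t_leu].
  have t_gt0 : 0 < t by rewrite lt_neqAle eq_sym t0.
  have t_ltu : t < height u by rewrite lt_neqAle tu.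
  by case/negP: s01; rewrite divr_gt0//= ltr_pdivrMr// mul1r.
have /andP[s0 s1] := s01.
have -> : slice (dome G u) t = [set x | G ((1 - t / height u)^-1 *:
    (x - (t / height u) *: col' ord_max u))].
  by apply/seteqP; split => x; [case/slice_dome|move=> Gx; exact/slice_dome].
rewrite lebesgue_rV_dilate ?subr_gt0// G1 mule1 /cone_profile ifT//.
have tE : t = t / height u * height u by rewrite divfK// gt_eqF.
by rewrite {1 2}tE mulr_ge0 ?(ltW s0) ?(ltW u0)//= ler_piMl ?(ltW s1) ?(ltW u0).
Qed.

Lemma lebesgue_dome G u : (0 < n)%N -> measurable G ->
  lebesgue_rV G = 1%E -> 0 <= height u ->
  lebesgue_rV (dome G u) = (height u / n.+1%:R)%:E.
Proof.
move=> n0 mG G1; rewrite le_eqVlt => /orP[/eqP u0|u0].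
  rewrite -u0 mul0r (_ : dome G u = set0) ?measure0//.
  by apply/seteqP; split => v // [/andP[+ _]]; rewrite -u0 invr0 mulr0 ltxx.
have mD := measurable_dome u mG.
rewrite lebesgue_rV_slice// -integral_cone_profile//.
apply: (@integral_eq_off_point _ _ _ 0) => //.
- exact: measurable_lebesgue_slice.
- by apply/measurable_EFinP; exact: measurable_cone_profile.
- by move=> t; rewrite lee_fin cone_profile_ge0.
move=> t t0; have [->|tu] := eqVneq t (height u); last exact: lebesgue_slice_dome.
have -> : slice (dome G u) (height u) = set0.
  apply/seteqP; split => x // /slice_dome[].
  by rewrite divff ?gt_eqF// ltxx andbF.
rewrite measure0 /cone_profile divff ?gt_eqF// subrr expr0n gtn_eqF//.
by case: ifP.
Qed.

End dome_measure.

(** * Two random points *)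

Section two_points.
Context {R : realType}.
Local Notation mu := (@lebesgue_measure R).
Local Notation height v := (v ord0 ord_max).

Lemma iid2E d (T : measurableType d) (P : probability T R)
    (S : set (2.-tuple T)) :
  measurable [set p : T * T | S [tuple p.1; p.2]] ->
  iid P S = (P \x P)%E [set p : T * T | S [tuple p.1; p.2]].
Proof.
move=> mS; rewrite /= /pushforward; apply: eq_integral => u _ /=.
set S' := [set p | _] in mS *.
have mSu : measurable (xsection S' u) by exact: measurable_xsection.
rewrite -[xsection S' u in RHS]setIT -integral_indic//.
apply: eq_integral => v _ /=; rewrite diracE indicE.
have tE : [tuple of u :: [tuple v]] = [tuple u; v] by exact: val_inj.
congr (_%:R)%:E; congr nat_of_bool.
apply/idP/idP; rewrite /xsection !inE/= ?inE /S'/= -tE.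
  by move=> /set_mem.
by move=> Suv; apply/mem_set.
Qed.

Lemma measurable_asym d (T : measurableType d) (G : set (T * T)) : measurable G ->
  measurable [set p : T * T | ~ G p /\ ~ G (p.2, p.1)].
Proof.
move=> mG; apply: measurableI; first exact: measurableC.
apply: measurableC.
by have := @measurable_swap _ _ T T measurableT G mG; rewrite setTI.
Qed.

(** The complement is the union of G and its mirror image. They are disjoint by asymmetry, and
    computing the mirror image with the order of integration exchanged gives the same integral. *)
Lemma probability_asym d (T : measurableType d) (P : probability T R)
    (G : set (T * T)) : measurable G -> (forall x y, G (x, y) -> ~ G (y, x)) ->
  ((P \x P) [set p | ~ G p /\ ~ G (p.2, p.1)] =
   1 - (\int[P]_x P [set y | G (x, y)] + \int[P]_x P [set y | G (x, y)]))%E.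
Proof.
move=> mG asymG; pose G' := [set p : T * T | G (p.2, p.1)].
have mG' : measurable G'.
  by have := @measurable_swap _ _ T T measurableT G mG; rewrite setTI.
have -> : [set p | ~ G p /\ ~ G (p.2, p.1)] = ~` (G `|` G').
  by apply/seteqP; split => p /=; [move=> [h h'] []|move=> h; split => ?; apply: h; [left|right]].
rewrite (probability_setC (P \x P)%E); last exact: measurableU.
rewrite measureU//; last first.
  by apply/seteqP; split => // -[x y] [/asymG].
congr (1 - (_ + _))%E.
  apply: eq_integral => x _ /=; congr (P _).
  by apply/seteqP; split => y /=; rewrite /xsection/= inE.
transitivity ((P \x P)%E G') => //.
rewrite (product_measure_unique (m' := (P \x^ P)%E))//; last first.
  by move=> *; exact: product_measure2E.
apply: eq_integral => x _ /=; congr (P _).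
by apply/seteqP; split => y /=; rewrite /ysection/= inE.
Qed.

Lemma measurable_fun_section d (T : measurableType d) (P : probability T R)
    (G : set (T * T)) : measurable G ->
  measurable_fun setT (fun x => P [set y | G (x, y)]).
Proof.
move=> mG; have -> : (fun x => P [set y | G (x, y)]) = P \o xsection G.
  apply/funext => x /=; congr (P _).
  by apply/seteqP; split => y /=; rewrite /xsection/= inE.
exact: measurable_fun_xsection.
Qed.

Context {n : nat}.
Implicit Types (F : set 'rV[R]_n) (K : set 'rV[R]_n.+1).
Local Notation base F := (cylinder F [set 0]).

(** Both points belong to the hull, so being on the boundary only means not being interior. *)
Lemma convex_position2E F (u v : 'rV[R]_n.+1) : convex_set F -> F !=set0 ->
  convex_position_with_floor F [tuple u; v] <-> ~ dome F° u v /\ ~ dome F° v u.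
Proof.
move=> cF F0; rewrite -(interior_hullP u v cF F0) -(interior_hullP v u cF F0).
rewrite (setUC [set v] [set u]) /convex_position_with_floor/= /boundary.
have -> : [set` [tuple u; v]] = [set u; v].
  apply/seteqP; split => x /=; last by move=> [->|->]; rewrite !inE eqxx ?orbT.
  by rewrite !inE => /orP[/eqP->|/eqP->]; [left|right].
set H := conv_hull _.
have subH : [set u; v] `|` base F `<=` H by exact: sub_gen_smallest.
split=> [bd|[nv nu] i].
  split; first by have [_] := bd (lift ord0 ord0).
  by have [_] := bd ord0.
case: i => [[|[|//]] i2] /=.
  by split => //; apply: subset_closure; apply: subH; left; left.
by split => //; apply: subset_closure; apply: subH; left; right.
Qed.

Lemma measurable_height K : measurable_fun K (fun x => (height x)%:E).
Proof.
have mh : measurable_fun [set: 'rV[R]_n.+1] (fun x => (height x)%:E).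
  by apply/measurable_EFinP; exact: measurable_coord_rV.
by apply: measurable_funS mh.
Qed.

Lemma integral_height K : measurable K -> K `<=` [set x | 0 <= height x] ->
  (\int[lebesgue_rV]_(x in K) (height x)%:E =
   \int[mu]_t (t%:E * lebesgue_rV (slice K t)))%E.
Proof.
move=> mK K0; rewrite integral_mkcond ge0_integral_rV; last 2 first.
- apply/(measurable_restrictT _ _).1; first exact: mK.
  exact: measurable_height.
- move=> x; rewrite patchE; case: ifPn => //; rewrite inE => Kx.
  by rewrite lee_fin; exact: K0.
apply: eq_integral => t _.
have [t0|t0] := leP 0 t; last first.
  have -> : slice K t = set0.
    apply/seteqP; split => x // /K0/=; rewrite mxE unlift_none/=.
    by rewrite leNgt t0.
  rewrite measure0 mule0 integral0_eq// => x _; rewrite patchE.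
  case: ifPn => //; rewrite inE => /K0/=; rewrite mxE unlift_none/=.
  by rewrite leNgt t0.
have mKt := measurable_slice t mK.
rewrite -[slice K t in RHS]setIT -integral_indic// -ge0_integralZl//; last first.
  by apply/measurable_EFinP; exact: measurable_indic.
apply: eq_integral => x _; rewrite patchE indicE.
have -> : (x \in slice K t) = (rV_rcons (x, t) \in K) by [].
by case: ifPn => _; rewrite ?mule0// mxE unlift_none/= mule1.
Qed.

(** The hypotheses on K are those shared by the bodies of [SubPrism] and by the unit mountains,
    whose apex may project outside F. *)
Lemma Q2E F K : (0 < n)%N -> measurable F -> convex_set F -> lebesgue_rV F = 1%E ->
  measurable K -> convex_set K -> base F `<=` K ->
  K `<=` [set x | 0 <= height x] -> lebesgue_rV K = 1%E ->
  (Q F K 2 = 1 - (2 / n.+1%:R)%R%:E * \int[mu]_t (t%:E * lebesgue_rV (slice K t)))%E.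
Proof.
move=> n0 mF cF F1 mK cK FK K0 K1.
have F_neq0 := lebesgue_rV1_nonempty F1.
have [||P PE] := uniform_law_probability mK.
- by rewrite K1 lte01.
- by rewrite K1 ltry.
have PA A : P A = lebesgue_rV (A `&` K).
  by rewrite -PE /uniform_law K1 inve1 mule1.
have mFi : measurable F° by apply: open_measurable_rV; exact: open_interior.
have Fi1 := lebesgue_rV_interior mF cF F1.
have mG := measurable_dome_graph mFi.
have SE : [set p : 'rV[R]_n.+1 * 'rV[R]_n.+1 |
    convex_position_with_floor F [tuple p.1; p.2]] =
    [set p | ~ dome F° p.1 p.2 /\ ~ dome F° p.2 p.1].
  by apply/seteqP; split => p /(convex_position2E _ _ cF F_neq0).
rewrite /Q PE iid2E SE; last exact: (measurable_asym mG).
have := probability_asym P mG; rewrite /= => ->; last first.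
  move=> u v [/andP[s0 s1] _] [/andP[s0' s1'] _].
  (* Two inverse ratios cannot both lie in ]0, 1[, so the two ways of failing exclude each other. *)
  have : (height v / height u) * (height u / height v) = 1.
    rewrite mulrA divfK ?divff//.
      by apply/eqP => h; move: s0; rewrite h mul0r ltxx.
    by apply/eqP => h; move: s0; rewrite h invr0 mulr0 ltxx.
  move=> h; have := mulr_ilt1 (ltW s0) (ltW s0') s1 s1'.
  by rewrite h ltxx.
have domeK u : K u -> dome F° u `<=` K.
  move=> Ku v [? Fv]; have : cone (base F) u v.
    by apply: dome_sub_cone; split => //; exact: interior_subset.
  exact: cone_sub.
have mPd : measurable_fun setT (fun u => P (dome F° u)).
  exact: (measurable_fun_section P mG).
have Pdome : (\int[P]_u P (dome F° u) =
    n.+1%:R^-1%:E * \int[mu]_t (t%:E * lebesgue_rV (slice K t)))%E.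
  (* P has no mass outside K and is Lebesgue measure inside, since K has volume 1. *)
  rewrite -[X in integral _ X _](setUv K) ge0_integral_setU//; last 3 first.
  - exact: measurableC.
  - by rewrite setUv.
  - by rewrite disj_set2E setICr.
  rewrite [X in (_ + X)%E](_ : _ = 0%E); last first.
    rewrite (eq_measure_integral mzero) ?integral_measure_zero//.
    move=> A mA AK; change (P A = 0%E); rewrite PA (_ : A `&` K = set0) ?measure0//.
    by apply/seteqP; split => x // [/AK].
  rewrite adde0 (eq_measure_integral lebesgue_rV); last first.
    by move=> A mA AK; change (P A = lebesgue_rV A); rewrite PA setIidl.
  rewrite -integral_height// -ge0_integralZl//; last exact: measurable_height.
  apply: eq_integral => u; rewrite inE => Ku.
  rewrite PA setIidl; last exact: domeK.
  rewrite lebesgue_dome//; last exact: K0.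
  by rewrite -EFinM mulrC.
have -> : (fun x => P [set y | dome F° x y]) = (fun x => P (dome F° x)) by [].
rewrite Pdome -ge0_muleDl ?lee_fin ?invr_ge0//; congr (_ - _ * _)%E.
by rewrite -EFinD -mulr2n mulr_natl.
Qed.

End two_points.

(** * First moments of the slice volumes *)

Section moments.
Context {R : realType} {n : nat}.
Implicit Types (F : set 'rV[R]_n) (K : set 'rV[R]_n.+1).
Local Notation mu := (@lebesgue_measure R).
Local Notation height v := (v ord0 ord_max).
Local Notation base F := (cylinder F [set 0]).

Definition slice_volume K (t : R) : R := fine (lebesgue_rV (slice K t)).

Lemma compact_sup_bounded F : compact F -> exists2 N, 0 <= N & sup_bounded N F.
Proof.
move=> /compact_bounded[M [_ MF]].
(* The norm bound is available for every number above M, such as [|M| + 1]; the second unit gives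
   the strict inequality of a ball. *)
exists (`|M| + 2); first by rewrite addr_ge0.
move=> x Fx i; have xM : `|x| <= `|M| + 1.
  by apply: MF => //; rewrite (le_lt_trans (ler_norm M))// ltrDl.
have /ball_rV_normP/ball_rVP[_ /(_ i)] : `|0 - x| < `|M| + 2.
  by rewrite sub0r normrN; lra.
by rewrite mxE sub0r normrN => /ltW.
Qed.

(** With l = t / t1, convexity puts (1 - l) F + l K_t1 inside the slice K_t, and 1 - l and l * c are
    the radii for the Brunn-Minkowski inequality. *)
Lemma brunn_minkowski_slice F K (t t1 c : R) : compact F -> measurable F ->
  lebesgue_rV F = 1%E -> measurable K -> convex_set K -> base F `<=` K ->
  (forall s, slice K s `<=` F) ->
  0 <= t < t1 -> slice K t1 !=set0 -> 0 <= c ->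
  ((c ^+ n)%:E <= lebesgue_rV (slice K t1))%E ->
  (((1 - t / t1 + t / t1 * c) ^+ n)%:E <= lebesgue_rV (slice K t))%E.
Proof.
move=> cF mF F1 mK /convex_setP cK FK KF /andP[t0 tt1] [y1 Ky1] c0 cK1.
have t10 : 0 < t1 by exact: le_lt_trans tt1.
pose l := t / t1; have l0 : 0 <= l by rewrite divr_ge0// ltW.
have l1 : l < 1 by rewrite ltr_pdivrMr// mul1r.
have ol0 : 0 < 1 - l by rewrite subr_gt0.
have combK x y : F x -> slice K t1 y -> slice K t ((1 - l) *: x + l *: y).
  move=> Fx Ky; have := cK _ _ (1 - l) (FK _ (base_rcons Fx)) Ky.
  rewrite subKr rV_rcons_comb mulr0 add0r /l divfK ?gt_eqF//; apply.
  by rewrite subr_ge0 ltW//= gerBl.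
have mKt := measurable_slice t mK; have mKt1 := measurable_slice t1 mK.
(* [brunn_minkowski] takes positive radii. If l * c = 0, the translate of (1 - l) F by l * y1 is
   large enough. *)
rewrite -/l; have [lc0|lc0] := eqVneq (l * c) 0.
  rewrite lc0 addr0 -[leLHS]mule1 -F1 -(lebesgue_rV_dilate (l *: y1) ol0 mF).
  rewrite le_measure ?inE//; first exact: measurable_dilate.
  move=> x /= /combK/(_ Ky1).
  by rewrite scalerA divff ?gt_eqF// scale1r subrK.
have [l_gt0 c_gt0] : 0 < l /\ 0 < c.
  by move: lc0; rewrite mulf_eq0 negb_or !lt_neqAle l0 c0 !andbT !(eq_sym 0) => /andP.
have [N N0 FN] := compact_sup_bounded cF.
have FN' (k : R) (A : set 'rV[R]_n) : 0 < k <= 1 -> A `<=` F ->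
    sup_bounded N [set x | A (k^-1 *: (x - 0))].
  move=> /andP[k0 k1] AF x /= /AF /FN xN i; have := xN i.
  rewrite subr0 mxE normrM gtr0_norm ?invr_gt0// ler_pdivrMl// => /le_trans; apply.
  by rewrite ler_piMl.
apply: (brunn_minkowski (N := N) (A := [set x | F ((1 - l)^-1 *: (x - 0))])
  (B := [set x | slice K t1 (l^-1 *: (x - 0))])) => //.
- exact: measurable_dilate.
- exact: measurable_dilate.
- by apply: FN' => //; rewrite ol0 gerBl.
- by apply: FN' => //; rewrite l_gt0 ltW.
- by move=> x /KF/FN.
- move=> x y /= Fx Ky; have := combK _ _ Fx Ky.
  by rewrite !scalerA !divff ?gt_eqF// !scale1r !subr0.
- exact: mulr_gt0.
- by rewrite lebesgue_rV_dilate// F1 mule1.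
- by rewrite lebesgue_rV_dilate// exprMn EFinM lee_pmul// lee_fin exprn_ge0.
Qed.

Section sub_prism.
Variables (F : set 'rV[R]_n) (K : set 'rV[R]_n.+1).
Hypotheses (n0 : (0 < n)%N) (cF : compact F) (F1 : lebesgue_rV F = 1%E) (FK : SubPrism F K).

Let mF : measurable F := compact_measurable_rV cF.

Let mK : measurable K. Proof. by case: FK => /compact_measurable_rV. Qed.

Lemma SubPrism_base : base F `<=` K.
Proof. by have [_ _ [_ <-] _ _] := FK; move=> x []. Qed.

Lemma SubPrism_slice t : slice K t `<=` F.
Proof.
have [_ _ _ _ [H _ KH]] := FK; move=> x /KH[+ _].
by rewrite col'_rcons.
Qed.

Lemma SubPrism_slice_itv : exists2 H, 0 <= H & forall t, slice K t !=set0 -> 0 <= t <= H.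
Proof.
have [_ _ _ _ [H H0 KH]] := FK; exists H => // t [x /KH[_]].
by rewrite /= mxE unlift_none/= in_itv.
Qed.

Lemma slice_volumeE t : (slice_volume K t)%:E = lebesgue_rV (slice K t).
Proof.
rewrite /slice_volume fineK// ge0_fin_numE ?measure_ge0//.
apply: (@le_lt_trans _ _ (lebesgue_rV F)); last by rewrite F1 ltry.
rewrite le_measure ?inE//; first exact: measurable_slice.
exact: SubPrism_slice.
Qed.

Lemma slice_volume_le1 t : slice_volume K t <= 1.
Proof.
rewrite -lee_fin slice_volumeE; apply: (@le_trans _ _ (lebesgue_rV F)); last by rewrite F1.
rewrite le_measure ?inE//; first exact: measurable_slice.
exact: SubPrism_slice.
Qed.

Lemma slice_volume_ge0 t : 0 <= slice_volume K t.
Proof. by rewrite fine_ge0// measure_ge0. Qed.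

Lemma slice_volume_eq0 t : ~ (slice K t !=set0) -> slice_volume K t = 0.
Proof.
move=> Kt; rewrite /slice_volume (_ : slice K t = set0) ?measure0//.
by apply/seteqP; split => x // Kx; apply: Kt; exists x.
Qed.

Lemma slice_volume0 : slice_volume K 0 = 1.
Proof.
rewrite /slice_volume (_ : slice K 0 = F) ?F1//.
apply/seteqP; split; first exact: SubPrism_slice.
by move=> x Fx; apply: SubPrism_base; exact: base_rcons.
Qed.

Lemma measurable_slice_volume : measurable_fun setT (slice_volume K).
Proof.
exact: (measurableT_comp (fine_measurable measurableT)
  (measurable_lebesgue_slice mK)).
Qed.

Lemma integral_slice_volume : (\int[mu]_t (slice_volume K t)%:E = 1)%E.
Proof.
have [_ _ _ <- _] := FK; rewrite lebesgue_rV_slice//.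
by apply: eq_integral => t _; exact: slice_volumeE.
Qed.

Let slice_volume_lt0 t : t < 0 -> slice_volume K t = 0.
Proof.
move=> t0; apply: slice_volume_eq0 => Kt.
have [H _ /(_ _ Kt)/andP[]] := SubPrism_slice_itv.
by rewrite leNgt t0.
Qed.

Let cone_profile_lt0 k h t : t < 0 -> cone_profile k h t = 0 :> R.
Proof. by move=> t0; rewrite /cone_profile (leNgt 0) t0. Qed.

Lemma prism_moment_le :
  (\int[mu]_t (t * cone_profile 0 1 t)%R%:E <= \int[mu]_t (t * slice_volume K t)%R%:E)%E.
Proof.
apply: (@le_moment_of_crossing _ _ _ 1) => //.
- exact: measurable_cone_profile.
- exact: measurable_slice_volume.
- by move=> t; exact: cone_profile_ge0.
- exact: slice_volume_ge0.
- by move=> t t0; rewrite cone_profile_lt0// slice_volume_lt0.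
- by rewrite integral_cone_profile// divr1.
- exact: integral_slice_volume.
- move=> t /andP[t0 t1]; rewrite /cone_profile t0 (ltW t1) expr0.
  exact: slice_volume_le1.
- by move=> t t1; rewrite /cone_profile (leNgt t) t1 andbF slice_volume_ge0.
Qed.

Lemma le_mountain_moment :
  (\int[mu]_t (t * slice_volume K t)%R%:E <=
   \int[mu]_t (t * cone_profile n n.+1%:R t)%R%:E)%E.
Proof.
have d0 : (0 : R) < n.+1%:R by rewrite ltr0n.
set d : R := n.+1%:R in d0 *.
(* The profiles cross at sup S. *)
pose S := [set t | slice K t !=set0 /\ cone_profile n d t <= slice_volume K t].
have [H H0 KH] := SubPrism_slice_itv.
have F_neq0 := lebesgue_rV1_nonempty F1.
have S0 : S 0.
  have [y Fy] := F_neq0; split.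
    by exists y; apply: SubPrism_base; exact: base_rcons.
  by rewrite slice_volume0 /cone_profile lexx (ltW d0) mul0r subr0 expr1n.
(* Nonemptiness of the slice in S provides the bound: above both bodies the two volumes are 0 and
   the inequality in S holds. *)
have Sub : has_ubound S by exists H => t [/KH/andP[]].
have ht0 : 0 <= sup S by apply: sup_ubound.
apply: (@le_moment_of_crossing _ _ _ (sup S)) => //.
- exact: measurable_slice_volume.
- exact: measurable_cone_profile.
- exact: slice_volume_ge0.
- by move=> t; exact: cone_profile_ge0.
- by move=> t t0; rewrite cone_profile_lt0// slice_volume_lt0.
- exact: integral_slice_volume.
- by rewrite integral_cone_profile// divff// gt_eqF.
- move=> t /andP[t0 tS].
  have [t1 [Kt1 t1S] tt1] := sup_gt (ex_intro S 0 S0) tS.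
  have t10 : 0 < t1 by exact: le_lt_trans tt1.
  rewrite {1}/cone_profile; case: ifPn => [/andP[_ td]|_]; last exact: slice_volume_ge0.
  (* Brunn-Minkowski for F and slice K t1 at the intermediate height t: the
     profile 1 - t / d is affine, hence the bound passes from t1 to t. *)
  pose c := Num.max 0 (1 - t1 / d).
  (* Up to height d, c is the n-th root of the mountain profile at t1; beyond d, c = 0, and c ^+ n =
     0 because 0 < n. *)
  have cn : c ^+ n <= slice_volume K t1.
    have [t1d|dt1] := leP t1 d.
      have c_ge0 : 0 <= 1 - t1 / d by rewrite subr_ge0 ler_pdivrMr// mul1r.
      by move: t1S; rewrite /c max_r// /cone_profile (ltW t10) t1d.
    rewrite /c max_l; first by rewrite expr0n gtn_eqF// slice_volume_ge0.
    by rewrite subr_le0 ler_pdivlMr// mul1r ltW.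
  have c0 : 0 <= c by rewrite le_max lexx.
  rewrite -lee_fin slice_volumeE.
  have [_ cK _ _ _] := FK.
  have tt1' : 0 <= t < t1 by rewrite t0.
  rewrite -lee_fin slice_volumeE in cn.
  have := brunn_minkowski_slice cF mF F1 mK cK SubPrism_base SubPrism_slice
    tt1' Kt1 c0 cn.
  apply: le_trans; rewrite lee_fin; apply: lerXn2r; rewrite ?nnegrE.
  + by rewrite subr_ge0 ler_pdivrMr// mul1r.
  + apply: addr_ge0; last by rewrite mulr_ge0// divr_ge0// ltW.
    by rewrite subr_ge0 ler_pdivrMr// mul1r ltW.
  + have : t / t1 * (1 - t1 / d) <= t / t1 * c.
      by rewrite ler_wpM2l ?divr_ge0 ?(ltW t10)// le_max lexx orbT.
    have -> : t / t1 * (1 - t1 / d) = t / t1 - t / d.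
      by rewrite mulrBr mulr1 mulrA divfK// gt_eqF.
    by move: (t / t1) (t / d) => l m; lra.
- move=> t St; have [Kt|Kt] := pselect (slice K t !=set0); last first.
    by rewrite slice_volume_eq0// cone_profile_ge0.
  rewrite leNgt; apply/negP => h.
  have : S t by split => //; exact: ltW.
  by move=> /(sup_ubound Sub); rewrite leNgt St.
Qed.

End sub_prism.

End moments.

(** * Slices of the prism and of the mountains *)

Section extremal_bodies.
Context {R : realType} {n : nat}.
Implicit Types (F : set 'rV[R]_n) (z : 'rV[R]_n.+1).
Local Notation mu := (@lebesgue_measure R).
Local Notation base F := (cylinder F [set 0]).

Lemma measurable_cylinder F (I : set R) : measurable F -> measurable I ->
  measurable (cylinder F I).
Proof.
move=> mF mI; have := measurable_rV_unrcons measurableT (measurableX mF mI).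
by rewrite setTI.
Qed.

Lemma convex_prism F : convex_set F -> convex_set (cylinder F `[0, 1]).
Proof.
move=> /convex_setP cF; apply/convex_setP => x y s [Fx x01] [Fy y01] s01.
move: x01 y01; rewrite /= !in_itv/= => /andP[x0 x1] /andP[y0 y1].
split; last first.
  have /andP[s0 s1] := s01.
  have os0 : 0 <= 1 - s by rewrite subr_ge0.
  rewrite /= in_itv/= !mxE addr_ge0 ?mulr_ge0//=.
  apply: (@le_trans _ _ (s * 1 + (1 - s) * 1)); last by lra.
  by apply: lerD; apply: ler_wpM2l.
have := cF _ _ _ Fx Fy s01; congr F.
by apply/rowP => i; rewrite !mxE.
Qed.

Lemma lebesgue_slice_prism F t : lebesgue_rV F = 1%E ->
  lebesgue_rV (slice (cylinder F `[0, 1]) t) = (cone_profile 0 1 t)%:E.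
Proof.
move=> F1; have sliceE x : slice (cylinder F `[0, 1]) t x <-> F x /\ 0 <= t <= 1.
  by rewrite /slice/cylinder/= col'_rcons mxE unlift_none/= in_itv.
rewrite /cone_profile; case: ifPn => t01.
  rewrite expr0 -F1; congr lebesgue_rV.
  by apply/seteqP; split => x; [case/sliceE|move=> Fx; exact/sliceE].
rewrite (_ : slice _ t = set0) ?measure0//.
by apply/seteqP; split => x // /sliceE[_]; rewrite (negbTE t01).
Qed.

Lemma mountainE F z : convex_set F -> F !=set0 -> mountain F z = cone (base F) z.
Proof.
move=> cF F0; have b0 := base_nonempty F0.
apply/seteqP; split.
  apply: smallest_sub; first exact/convex_cone/convex_base.
  by move=> x [bx|->]; [exact: sub_cone|exact: cone_apex].
apply: cone_sub; first exact: convex_conv_hull.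
  by move=> x bx; apply: sub_gen_smallest; left.
by apply: sub_gen_smallest; right.
Qed.

(** The three pieces are the points with apex weight s = 0, 0 < s < 1 and s = 1. The decomposition
    yields both measurability and the slice volumes. *)
Lemma mountain_decomp F z : convex_set F -> F !=set0 -> 0 < z ord0 ord_max ->
  mountain F z = base F `|` dome F z `|` [set z].
Proof.
move=> cF F0 z0; rewrite mountainE//; apply/seteqP; split; last first.
  move=> x [[bx|/dome_sub_cone//]|->]; first exact: sub_cone.
  exact/cone_apex/base_nonempty.
move=> x /cone_baseP[y [s [Fy /andP[s0 s1] xy xh]]].
have xE : x = rV_rcons (col' ord_max x, x ord0 ord_max).
  by rewrite -[LHS]rV_unrconsK.
have [s_eq0|s_neq0] := eqVneq s 0.
  left; left; split; last by rewrite /= xh s_eq0 mul0r.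
  by rewrite xy s_eq0 subr0 scale1r scale0r addr0.
have [s_eq1|s_neq1] := eqVneq s 1.
  right; rewrite /= xE xy xh s_eq1 subrr scale0r add0r scale1r mul1r.
  by rewrite -[RHS]rV_unrconsK.
left; right; rewrite /dome/= xh mulfK ?gt_eqF//.
rewrite !lt_neqAle eq_sym s_neq0 s0 s_neq1 s1; split => //.
by rewrite xy addrK scalerA mulVf ?scale1r// subr_eq0 eq_sym.
Qed.

Lemma measurable_mountain F z : measurable F -> convex_set F -> F !=set0 ->
  0 < z ord0 ord_max -> measurable (mountain F z).
Proof.
move=> mF cF F0 z0; rewrite mountain_decomp//.
apply: measurableU; last by apply: compact_measurable_rV; exact: compact_set1.
apply: measurableU; last exact: measurable_dome.
by apply: measurable_cylinder => //; exact: measurable_set1.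
Qed.

Lemma lebesgue_slice_mountain F z t : measurable F -> convex_set F ->
  lebesgue_rV F = 1%E -> F !=set0 -> 0 < z ord0 ord_max -> t != z ord0 ord_max ->
  lebesgue_rV (slice (mountain F z) t) = (cone_profile n (z ord0 ord_max) t)%:E.
Proof.
move=> mF cF F1 F0 z0 tz; rewrite mountain_decomp//.
have [->|t0] := eqVneq t 0.
  rewrite /cone_profile lexx ltW// mul0r subr0 expr1n -F1; congr lebesgue_rV.
  apply/seteqP; split => x; rewrite /slice/=; last by left; left; exact: base_rcons.
  case=> [[[+ _]|/slice_dome[]]|xz].
  - by rewrite col'_rcons.
  - by rewrite mul0r ltxx.
  - by move: z0; rewrite -xz mxE unlift_none/= ltxx.
rewrite -(lebesgue_slice_dome mF)//; congr lebesgue_rV.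
apply/seteqP; split => x; rewrite /slice/=; last by left; right.
case=> [[[_ /=]|//]|xz].
  by rewrite mxE unlift_none/= => /eqP; rewrite (negbTE t0).
by move: tz; rewrite -xz mxE unlift_none/= eqxx.
Qed.

Lemma lebesgue_mountain F z : measurable F -> convex_set F ->
  lebesgue_rV F = 1%E -> F !=set0 -> 0 < z ord0 ord_max ->
  lebesgue_rV (mountain F z) = (z ord0 ord_max / n.+1%:R)%:E.
Proof.
move=> mF cF F1 F0 z0; have mM := measurable_mountain mF cF F0 z0.
rewrite lebesgue_rV_slice// -integral_cone_profile//.
apply: (@integral_eq_off_point _ _ _ (z ord0 ord_max)) => //.
- exact: measurable_lebesgue_slice.
- by apply/measurable_EFinP; exact: measurable_cone_profile.
- by move=> t; rewrite lee_fin cone_profile_ge0.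
- by move=> t; exact: lebesgue_slice_mountain.
Qed.

Lemma mountain_ge0 F z : convex_set F -> F !=set0 -> 0 < z ord0 ord_max ->
  mountain F z `<=` [set x | 0 <= x ord0 ord_max].
Proof.
move=> cF F0 z0; rewrite mountainE// => x /cone_baseP[y [s [_ /andP[s0 _] _]]] /= ->.
by rewrite mulr_ge0// ltW.
Qed.

Lemma mountain_moment F z : measurable F -> convex_set F ->
  lebesgue_rV F = 1%E -> F !=set0 -> 0 < z ord0 ord_max ->
  (\int[mu]_t (t%:E * lebesgue_rV (slice (mountain F z) t)) =
   \int[mu]_t (t * cone_profile n (z ord0 ord_max) t)%R%:E)%E.
Proof.
move=> mF cF F1 F0 z0; have mM := measurable_mountain mF cF F0 z0.
apply: (@integral_eq_off_point _ _ _ (z ord0 ord_max)) => //.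
- by apply: emeasurable_funM => //; exact: measurable_lebesgue_slice.
- by apply/measurable_EFinP; apply: measurable_funM => //; exact: measurable_cone_profile.
- move=> t; have [t0|t0] := leP 0 t; first by rewrite mule_ge0.
  rewrite (_ : slice _ t = set0) ?measure0 ?mule0//.
  apply/seteqP; split => x // /(mountain_ge0 cF F0 z0)/=.
  by rewrite mxE unlift_none/= leNgt t0.
- move=> t; rewrite lee_fin; have [t0|t0] := leP 0 t.
    by rewrite mulr_ge0// cone_profile_ge0.
  by rewrite /cone_profile (leNgt 0 t) t0 mulr0.
- by move=> t tz; rewrite lebesgue_slice_mountain.
Qed.

End extremal_bodies.

(* The dimension is d = n.+1, so that F lives in R^n = R^(d-1) and the
   hypothesis d >= 2 reads 1 <= n. *)
Theorem theorem1 (R : realType) (n : nat) (F : set 'rV[R]_n)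
    (z : 'rV[R]_n.+1) :
  (1 <= n)%N ->
  compact F -> convex_set F -> lebesgue_rV F = 1%E ->
  z ord0 ord_max = n.+1%:R ->
  let P := cylinder F `[0, 1] in
  let M := mountain F z in
  [/\ lebesgue_rV M = 1%E,
      forall K : set 'rV[R]_n.+1, SubPrism F K ->
        (Q F M 2 <= Q F K 2)%E /\ (Q F K 2 <= Q F P 2)%E,
      Q F M 2 = (1 - 2 / (n.+1%:R + 1))%:E &
      Q F P 2 = (1 - 1 / n.+1%:R)%:E].
Proof.
move=> n0 cF vF F1 zd P M.
have mF := compact_measurable_rV cF.
have F0 := lebesgue_rV1_nonempty F1.
have d0 : (0 : R) < n.+1%:R by rewrite ltr0n.
have z0 : 0 < z ord0 ord_max by rewrite zd.
have M1 : lebesgue_rV M = 1%E by rewrite lebesgue_mountain// zd divff ?gt_eqF.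
have mP : measurable P by apply: measurable_cylinder => //; exact: measurable_itv.
have P1 : lebesgue_rV P = 1%E.
  rewrite lebesgue_rV_slice//.
  under eq_integral do rewrite lebesgue_slice_prism//.
  by rewrite integral_cone_profile// divr1.
have QM : Q F M 2 = (1 - (2 / n.+1%:R)%R%:E *
    \int[lebesgue_measure]_t (t * cone_profile n n.+1%:R t)%R%:E)%E.
  rewrite Q2E//.
  - by rewrite mountain_moment// zd.
  - exact: measurable_mountain.
  - exact: convex_conv_hull.
  - by move=> x bx; apply: sub_gen_smallest; left.
  - exact: mountain_ge0.
have QP : Q F P 2 = (1 - (2 / n.+1%:R)%R%:E *
    \int[lebesgue_measure]_t (t * cone_profile 0 1 t)%R%:E)%E.
  rewrite Q2E//.
  - by under eq_integral do rewrite lebesgue_slice_prism// -EFinM.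
  - exact: convex_prism.
  - by move=> x [Fx /= x0]; split => //=; rewrite x0 in_itv/= lexx ler01.
  - by move=> x [_ /=]; rewrite in_itv/= => /andP[].
split; first exact: M1.
- move=> K FK; have [cK vK [K0 _] K1 _] := FK.
  have mK := compact_measurable_rV cK.
  have QK : Q F K 2 = (1 - (2 / n.+1%:R)%R%:E *
      \int[lebesgue_measure]_t (t * slice_volume K t)%R%:E)%E.
    rewrite Q2E//; last exact: SubPrism_base.
    by under [in RHS]eq_integral => t _ do rewrite EFinM (slice_volumeE cF F1 FK).
  have k0 : (0 <= (2 / n.+1%:R)%R%:E :> \bar R)%E by rewrite lee_fin divr_ge0.
  (* The order is reversed: a larger moment gives a smaller probability. *)
  rewrite QM QK QP; split; apply: leeB => //; apply: lee_wpmul2l => //.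
    exact: (le_mountain_moment n0 cF F1 FK).
  exact: (prism_moment_le cF F1 FK).
(* With d = n + 1, the moment of the mountain is d^2 / (d (d + 1)) = d / (d + 1). *)
- rewrite QM moment_cone_profile// -EFinM -EFinB natr1; congr EFin.
  congr (_ - _); rewrite expr2 -!mulrA; congr (_ * _).
  by rewrite invfM !mulrA mulVf ?gt_eqF// mul1r divff ?gt_eqF// mul1r.
(* The moment of the prism is 1/2, the mean height. *)
- rewrite QP moment_cone_profile// -EFinM -EFinB; congr EFin.
  by congr (_ - _); rewrite expr1n !mul1r mulrAC divff ?pnatr_eq0// mul1r.
Qed.
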